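(* Every quasi-Hadamard lacunary series $\sum_{n=0}^\infty a_n z^n$ with radius of convergence $r>0$ has the disc $B(r,0)$ as a domain of holomorphy.
   Context: $B(r,0)$ denotes the open disc in $\mathbb{C}$ centred at the origin with radius $r$. That the power series $f(z)=\sum a_nz^n$ has $B(r,0)$ as a domain of holomorphy means that every point of $\partial B(r,0)$ is a singular point of $f$, i.e. $f$ has no holomorphic extension to a neighbourhood of any boundary point ($\partial B(r,0)$ is a natural boundary). An infinite complex power series $\sum_{v=0}^\infty a_v z^v$ is called a quasi-Hadamard lacunary series if there exist a $\delta>0$, a summable positive decreasing sequence $(c_j)_{j\ge0}$ with $c_j\searrow0$, and an increasing sequence $(m_v)_{v\ge0}$ of non-negative integers such that: (i) $m_{v+1}-m_v>\delta m_v$ for $v=0,1,2,\dots$; (ii) $|a_j|\le\frac{1}{m_v^2}c_j$ if $m_v<j<m_{v+1}$, $v=0,1,2,\dots$; and (iii) the series $\sum_{v=0}^\infty|a_{m_v}|$ is divergent. *)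

(* Defs.v *)
From Stdlib Require Import Reals.
From Coquelicot Require Export Coquelicot.

Open Scope R_scope.

(** Coquelicot's [CV_radius] only covers real coefficients; this is the supremum
    of [|z|] over the [z] at which the complex power series converges. *)
Definition C_CV_radius (a : nat -> C) : Rbar :=
  Lub_Rbar (fun x : R => exists z : C, Cmod z = x /\ ex_pseries a z).

(** [ex_derive] is taken over the field [C], i.e. complex differentiability. *)
Definition holomorphic_on (U : C -> Prop) (f : C -> C) : Prop :=
  forall z : C, U z -> ex_derive (K := C_AbsRing) (V := C_NormedModule) f z.

(** [f] is only looked at on the disc [B(r,0)]; its values outside are irrelevant. *)
Definition singular_point (r : R) (f : C -> C) (w : C) : Prop :=
  ~ exists (U : C -> Prop) (g : C -> C),
      open U /\ U w /\ holomorphic_on U g /\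
      (forall z : C, U z -> Cmod z < r -> g z = f z).

Definition disc_is_domain_of_holomorphy (r : R) (f : C -> C) : Prop :=
  forall w : C, Cmod w = r -> singular_point r f w.

(** The bound on the gap coefficients involves [1 / m_v^2]; when [m_v = 0]
    (possible only for [v = 0]) it is read as [+oo], so nothing is required. *)
Definition quasi_Hadamard_lacunary (a : nat -> C) : Prop :=
  exists (delta : R) (c : nat -> R) (m : nat -> nat),
    0 < delta /\
    (forall j : nat, 0 < c j) /\
    (forall j : nat, c (S j) <= c j) /\
    is_lim_seq c 0 /\
    ex_series c /\
    (forall v : nat, (m v < m (S v))%nat) /\
    (forall v : nat, INR (m (S v)) - INR (m v) > delta * INR (m v)) /\
    (forall v j : nat, (m v < j < m (S v))%nat -> (0 < m v)%nat ->
       Cmod (a j) <= 1 / INR (m v) ^ 2 * c j) /\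
    ~ ex_series (fun v : nat => Cmod (a (m v))).

(* Main.v *)
Require Import Defs.
From Stdlib Require Import Reals Lra Lia Classical ClassicalEpsilon.
From Coquelicot Require Import Coquelicot.
Open Scope R_scope.

(** Divergence of [sum |a_(m_v)|] forces [r <= 1]. If [f] extends past a point [w] of the
    circle, let [h] be the glued function and compose it with Hadamard's map
    [x |-> w (x^p + x^(p+1)) / 2], where [p delta >= 1]: the result is holomorphic on a disc of
    radius [q > 1], so by Cauchy's estimate its Taylor coefficients [F n] are [O(q^-n)].
    The power [m_v] only feeds the coefficients with [p m_v <= n <= (p + 1) m_v], and these
    blocks are disjoint, so [F n] is a single lacunary contribution plus gap contributions.
    As [sum |a_j|] over the gaps is finite, summing over [n] bounds
    [sum |a_j| (r sigma)^j], [sigma = (rho^p + rho^(p+1)) / 2], whenever [1 <= rho < q] and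
    [r sigma <= 1]. For [r = 1] take [rho = 1] and contradict the divergence; for [r < 1] take
    [rho > 1] and contradict the radius of convergence.

    Cauchy's estimate is obtained from [G u = h (exp u) exp (- n u)], whose integral over a
    vertical segment of length [2 PI] does not depend on the abscissa by Goursat's theorem;
    at abscissa [-oo] it is [2 PI] times the [n]-th coefficient. *)

(* Coquelicot's lemmas leave equalities and sums typed in structure carriers, where [ring]
   does not recognise [R] or [C]. *)
Ltac as_R := match goal with |- @eq _ ?a ?b => change (@eq R a b) end.

Ltac as_C :=
  repeat match goal with |- context [@plus _ ?a ?b] => change (@plus _ a b) with (a + b)%C end;
  match goal with |- @eq _ ?a ?b => change (@eq C a b) end.

(** * Goursat's theorem on rectangles *)

(** The integral of [P dx + Q dy] along the boundary of the rectangle with sides [[a, b]] and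
    [[c, d]], taken counterclockwise. *)
Definition circulation (P Q : R -> R -> R) (a b c d : R) : R :=
  RInt (fun x => P x c) a b + RInt (fun y => Q b y) c d
  - RInt (fun x => P x d) a b - RInt (fun y => Q a y) c d.

(** The shared [q] encodes closedness, as it is both the [y]-derivative of [P] and the
    [x]-derivative of [Q]. Differentiability is only pointwise, with no continuity of the partial
    derivatives. *)
Definition closed_form_at (P Q : R -> R -> R) (x y : R) : Prop :=
  exists p q s, differentiable_pt_lim P x y p q /\ differentiable_pt_lim Q x y q s.

(** The supremum of the left endpoints works, because each left endpoint lies below every right
    endpoint. *)
Lemma nested_intervals (a b : nat -> R) :
  (forall n, a n <= a (S n)) -> (forall n, b (S n) <= b n) ->
  (forall n, a n <= b n) ->
  exists x, forall n, a n <= x <= b n.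
Proof.
  intros Ha Hb Hab.
  assert (Hincr : forall n k, a n <= a (n + k)%nat).
  { intros n k; induction k as [|k IH].
    - rewrite Nat.add_0_r; lra.
    - rewrite Nat.add_succ_r; specialize (Ha (n + k)%nat); lra. }
  assert (Hdecr : forall n k, b (n + k)%nat <= b n).
  { intros n k; induction k as [|k IH].
    - rewrite Nat.add_0_r; lra.
    - rewrite Nat.add_succ_r; specialize (Hb (n + k)%nat); lra. }
  assert (Hall : forall i n, a i <= b n).
  { intros i n.
    apply Rle_trans with (a (i + n)%nat); [apply Hincr|].
    apply Rle_trans with (b (i + n)%nat); [apply Hab|].
    rewrite Nat.add_comm; apply Hdecr. }
  destruct (completeness (fun x => exists i, x = a i)) as [x [Hub Hlub]].
  - exists (b 0%nat); intros y [i ->]; apply Hall.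
  - exists (a 0%nat); now exists 0%nat.
  - exists x; intros n; split.
    + apply Hub; now exists n.
    + apply Hlub; intros y [i ->]; apply Hall.
Qed.

Lemma differentiable_continuous_x (f : R -> R -> R) (x y p q : R) :
  differentiable_pt_lim f x y p q -> continuous (fun t => f t y) x.
Proof.
  intros H.
  apply (ex_derive_continuous (K := R_AbsRing) (V := R_NormedModule)).
  exists p; apply is_derive_Reals.
  replace p with (p * 1 + q * 0) by ring.
  apply (derivable_pt_lim_comp_2d f (fun t => t) (fun _ => y) x p q 1 0 H).
  - apply derivable_pt_lim_id.
  - apply derivable_pt_lim_const.
Qed.

Lemma differentiable_continuous_y (f : R -> R -> R) (x y p q : R) :
  differentiable_pt_lim f x y p q -> continuous (fun t => f x t) y.
Proof.
  intros H.
  apply (ex_derive_continuous (K := R_AbsRing) (V := R_NormedModule)).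
  exists q; apply is_derive_Reals.
  replace q with (p * 0 + q * 1) by ring.
  apply (derivable_pt_lim_comp_2d f (fun _ => x) (fun t => t) y p q 0 1 H).
  - apply derivable_pt_lim_const.
  - apply derivable_pt_lim_id.
Qed.

Section Rectangle.

Variables (P Q : R -> R -> R) (a b c d : R).
Hypothesis closed : forall x y, a <= x <= b -> c <= y <= d -> closed_form_at P Q x y.

Lemma ex_RInt_horizontal (y u v : R) :
  c <= y <= d -> a <= u -> u <= v -> v <= b -> ex_RInt (fun x => P x y) u v.
Proof.
  intros Hy Hu Huv Hv.
  apply (ex_RInt_continuous (V := R_CompleteNormedModule)).
  intros x; rewrite Rmin_left, Rmax_right by lra; intros Hx.
  destruct (closed x y) as (p & q & s & H1 & H2); try lra.
  now apply differentiable_continuous_x with p q.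
Qed.

Lemma ex_RInt_vertical (x u v : R) :
  a <= x <= b -> c <= u -> u <= v -> v <= d -> ex_RInt (fun y => Q x y) u v.
Proof.
  intros Hx Hu Huv Hv.
  apply (ex_RInt_continuous (V := R_CompleteNormedModule)).
  intros y; rewrite Rmin_left, Rmax_right by lra; intros Hy.
  destruct (closed x y) as (p & q & s & H1 & H2); try lra.
  now apply differentiable_continuous_y with q s.
Qed.

(** Each inner edge is traversed twice in opposite directions, so its contributions cancel. *)
Lemma circulation_split (u v k l m n : R) :
  a <= u -> u <= v -> v <= k -> k <= b -> c <= l -> l <= m -> m <= n -> n <= d ->
  circulation P Q u k l n =
    circulation P Q u v l m + circulation P Q v k l m
    + circulation P Q u v m n + circulation P Q v k m n.
Proof.
  intros.
  assert (HP : forall y, c <= y <= d ->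
    RInt (fun x => P x y) u k = RInt (fun x => P x y) u v + RInt (fun x => P x y) v k).
  { intros y Hy; symmetry; apply (RInt_Chasles (V := R_CompleteNormedModule));
      apply ex_RInt_horizontal; lra. }
  assert (HQ : forall x, a <= x <= b ->
    RInt (fun y => Q x y) l n = RInt (fun y => Q x y) l m + RInt (fun y => Q x y) m n).
  { intros x Hx; symmetry; apply (RInt_Chasles (V := R_CompleteNormedModule));
      apply ex_RInt_vertical; lra. }
  unfold circulation; rewrite 2!HP, 2!HQ by lra; ring.
Qed.

End Rectangle.

Lemma RInt_near_affine (f : R -> R) (a b alpha beta M : R) :
  a <= b -> ex_RInt f a b ->
  (forall t, a <= t <= b -> Rabs (f t - (alpha + beta * t)) <= M) ->
  Rabs (RInt f a b - (alpha * (b - a) + beta * (b ^ 2 - a ^ 2) / 2)) <= (b - a) * M.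
Proof.
  intros Hab Hf HM.
  assert (Hg : is_RInt (fun t => alpha + beta * t) a b
                 (alpha * (b - a) + beta * (b ^ 2 - a ^ 2) / 2)).
  { replace (alpha * (b - a) + beta * (b ^ 2 - a ^ 2) / 2)
      with (minus (alpha * b + beta * b ^ 2 / 2) (alpha * a + beta * a ^ 2 / 2))
      by (unfold minus, plus, opp; simpl; field).
    apply (is_RInt_derive (V := R_CompleteNormedModule) (fun t => alpha * t + beta * t ^ 2 / 2)).
    - intros x _; auto_derive; [exact I|field].
    - intros x _; apply (ex_derive_continuous (V := R_NormedModule)); auto_derive; exact I. }
  rewrite <- (is_RInt_unique (V := R_CompleteNormedModule) _ _ _ _ Hg).
  assert (Heg := ex_intro _ _ Hg : ex_RInt (fun t => alpha + beta * t) a b).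
  change (Rabs (minus (RInt f a b) (RInt (fun t => alpha + beta * t) a b)) <= (b - a) * M).
  rewrite <- (RInt_minus (V := R_CompleteNormedModule)) by assumption.
  apply abs_RInt_le_const; auto.
  apply (ex_RInt_minus (V := R_NormedModule)); auto.
Qed.

(** The affine part is a closed form because both components share [q], so its circulation vanishes.
    What remains is the error, at most [M] times the perimeter. *)
Lemma circulation_near_affine (P Q : R -> R -> R) (a b c d x0 y0 p q s M : R) :
  a <= b -> c <= d ->
  (forall x y, a <= x <= b -> c <= y <= d -> closed_form_at P Q x y) ->
  (forall x y, a <= x <= b -> c <= y <= d ->
     Rabs (P x y - P x0 y0 - (p * (x - x0) + q * (y - y0))) <= M /\
     Rabs (Q x y - Q x0 y0 - (q * (x - x0) + s * (y - y0))) <= M) ->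
  Rabs (circulation P Q a b c d) <= 2 * ((b - a) + (d - c)) * M.
Proof.
  intros Hab Hcd Hcl HM.
  assert (HP : forall y, c <= y <= d -> Rabs (RInt (fun x => P x y) a b
     - ((P x0 y0 - p * x0 + q * (y - y0)) * (b - a) + p * (b ^ 2 - a ^ 2) / 2)) <= (b - a) * M).
  { intros y Hy; apply RInt_near_affine; auto.
    - now apply (ex_RInt_horizontal P Q a b c d); try lra.
    - intros t Ht; destruct (HM t y Ht Hy) as [H _].
      replace (P t y - _) with (P t y - P x0 y0 - (p * (t - x0) + q * (y - y0))) by ring.
      exact H. }
  assert (HQ : forall x, a <= x <= b -> Rabs (RInt (fun y => Q x y) c d
     - ((Q x0 y0 + q * (x - x0) - s * y0) * (d - c) + s * (d ^ 2 - c ^ 2) / 2)) <= (d - c) * M).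
  { intros x Hx; apply RInt_near_affine; auto.
    - now apply (ex_RInt_vertical P Q a b c d); try lra.
    - intros t Ht; destruct (HM x t Hx Ht) as [_ H].
      replace (Q x t - _) with (Q x t - Q x0 y0 - (q * (x - x0) + s * (t - y0))) by ring.
      exact H. }
  assert (H1 := HP c ltac:(lra)); assert (H2 := HP d ltac:(lra)).
  assert (H3 := HQ a ltac:(lra)); assert (H4 := HQ b ltac:(lra)).
  unfold circulation.
  apply Rabs_le; revert H1 H2 H3 H4; intros
    [H1 H1']%Rabs_le_between [H2 H2']%Rabs_le_between
    [H3 H3']%Rabs_le_between [H4 H4']%Rabs_le_between.
  split; nra.
Qed.

Section Goursat.

Variables (P Q : R -> R -> R) (a b c d : R).
Hypothesis (Hab : a <= b) (Hcd : c <= d).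
Hypothesis closed : forall x y, a <= x <= b -> c <= y <= d -> closed_form_at P Q x y.

Let w n := (b - a) / 2 ^ n.
Let h n := (d - c) / 2 ^ n.
(** A rectangle of generation [n] is encoded by its lower left corner, since its sides [w n] and
    [h n] depend on [n] alone. *)
Let circ n (z : R * R) := circulation P Q (fst z) (fst z + w n) (snd z) (snd z + h n).
Let bad n (z : R * R) :=
  a <= fst z /\ fst z + w n <= b /\ c <= snd z /\ snd z + h n <= d /\
  Rabs (circulation P Q a b c d) / 4 ^ n <= Rabs (circ n z).

(** The circulations of the four quarters add up to that of the whole, so by the triangle inequality
    one quarter keeps at least a fourth of the modulus. *)
Lemma bad_step n (z : R * R) : bad n z ->
  exists z', bad (S n) z' /\
    fst z <= fst z' /\ fst z' + w (S n) <= fst z + w n /\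
    snd z <= snd z' /\ snd z' + h (S n) <= snd z + h n.
Proof.
  destruct z as [x y]; intros (H1 & H2 & H3 & H4 & H5); simpl in *.
  assert (Hw : w n = 2 * w (S n)).
  { unfold w; simpl; field; apply pow_nonzero; lra. }
  assert (Hh : h n = 2 * h (S n)).
  { unfold h; simpl; field; apply pow_nonzero; lra. }
  assert (w0 : 0 <= w (S n)).
  { apply Rdiv_le_0_compat; [lra|apply pow_lt; lra]. }
  assert (h0 : 0 <= h (S n)).
  { apply Rdiv_le_0_compat; [lra|apply pow_lt; lra]. }
  unfold circ in H5; simpl in H5.
  rewrite (circulation_split P Q a b c d closed x (x + w (S n)) (x + w n)
             y (y + h (S n)) (y + h n)) in H5 by lra.
  replace (x + w n) with (x + w (S n) + w (S n)) in H5 by lra.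
  replace (y + h n) with (y + h (S n) + h (S n)) in H5 by lra.
  set (t := Rabs (circulation P Q a b c d) / 4 ^ n) in H5.
  assert (Ht : Rabs (circulation P Q a b c d) / 4 ^ S n = t / 4).
  { unfold t; simpl; field; apply pow_nonzero; lra. }
  set (K := fun z => circ (S n) z).
  assert (Hc : t / 4 <= Rabs (K (x, y)) \/ t / 4 <= Rabs (K (x + w (S n), y)) \/
               t / 4 <= Rabs (K (x, y + h (S n))) \/
               t / 4 <= Rabs (K (x + w (S n), y + h (S n)))).
  { destruct (Rle_dec (t / 4) (Rabs (K (x, y)))); [tauto|].
    destruct (Rle_dec (t / 4) (Rabs (K (x + w (S n), y)))); [tauto|].
    destruct (Rle_dec (t / 4) (Rabs (K (x, y + h (S n))))); [tauto|].
    destruct (Rle_dec (t / 4) (Rabs (K (x + w (S n), y + h (S n))))); [tauto|].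
    exfalso; unfold K, circ in *; simpl fst in *; simpl snd in *.
    match type of H5 with _ <= Rabs (?A + ?B + ?C + ?D) =>
      assert (T1 := Rabs_triang (A + B + C) D);
      assert (T2 := Rabs_triang (A + B) C);
      assert (T3 := Rabs_triang A B) end.
    lra. }
  unfold bad; rewrite Ht.
  destruct Hc as [Hc|[Hc|[Hc|Hc]]]; eexists; (split; [split; [|split; [|split; [|split; [|exact Hc]]]]|]);
    simpl; lra.
Qed.

Lemma goursat_rectangle : circulation P Q a b c d = 0.
Proof.
  assert (Hz : exists z : nat -> R * R, forall n, bad n (z n) /\
    fst (z n) <= fst (z (S n)) /\ fst (z (S n)) + w (S n) <= fst (z n) + w n /\
    snd (z n) <= snd (z (S n)) /\ snd (z (S n)) + h (S n) <= snd (z n) + h n).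
  (* Dependent choice: the invariant [bad] travels with the corner in a sigma type, so the recursion
     can always bisect again. *)
  { assert (Hstep : forall n (z : {z | bad n z}), {z' : {z' | bad (S n) z'} |
      fst (proj1_sig z) <= fst (proj1_sig z') /\
      fst (proj1_sig z') + w (S n) <= fst (proj1_sig z) + w n /\
      snd (proj1_sig z) <= snd (proj1_sig z') /\
      snd (proj1_sig z') + h (S n) <= snd (proj1_sig z) + h n}).
    { intros n [z Hb].
      apply ClassicalEpsilon.constructive_indefinite_description.
      destruct (bad_step n z Hb) as (z' & Hz' & H).
      now exists (exist _ z' Hz'). }
    assert (H0 : bad 0 (a, c)).
    { unfold bad, circ, w, h; simpl.
      replace (a + (b - a) / 1) with b by field; replace (c + (d - c) / 1) with d by field.
      repeat split; lra. }
    pose (zs := fix zs n : {z | bad n z} :=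
      match n with O => exist _ (a, c) H0 | S n => proj1_sig (Hstep n (zs n)) end).
    exists (fun n => proj1_sig (zs n)); intros n; split.
    - exact (proj2_sig (zs n)).
    - exact (proj2_sig (Hstep n (zs n))). }
  destruct Hz as [z Hz].
  assert (w0 : forall n, 0 <= w n).
  { intros n; apply Rdiv_le_0_compat; [lra|apply pow_lt; lra]. }
  assert (h0 : forall n, 0 <= h n).
  { intros n; apply Rdiv_le_0_compat; [lra|apply pow_lt; lra]. }
  destruct (nested_intervals (fun n => fst (z n)) (fun n => fst (z n) + w n)) as [x0 Hx0];
    try (intros n; specialize (Hz n); specialize (w0 n); tauto || lra).
  destruct (nested_intervals (fun n => snd (z n)) (fun n => snd (z n) + h n)) as [y0 Hy0];
    try (intros n; specialize (Hz n); specialize (h0 n); tauto || lra).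
  destruct (Req_dec (circulation P Q a b c d) 0) as [|HK]; [assumption|exfalso].
  apply Rabs_pos_lt in HK.
  destruct (closed x0 y0) as (p & q & s & HP & HQ).
  { destruct (Hz 0%nat) as [Hb _]; destruct Hb as (A1 & A2 & _).
    specialize (Hx0 0%nat); lra. }
  { destruct (Hz 0%nat) as [Hb _]; destruct Hb as (_ & _ & A1 & A2 & _).
    specialize (Hy0 0%nat); lra. }
  (* The [+ 1] keeps [L] positive for a degenerate rectangle. At scale [e = L / 2 ^ n] the perimeter
     is at most [2 * e], and with tolerance [K / (4 * L ^ 2)] the affine error is at most
     [K / (4 * L ^ 2) * e]. Their product is [K / 4 ^ n / 2], below the lower bound [K / 4 ^ n] kept
     by the bisection. *)
  set (L := (b - a) + (d - c) + 1).
  assert (L0 : 0 < L) by (unfold L; lra).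
  set (K := Rabs (circulation P Q a b c d)) in *.
  assert (He : 0 < K / (4 * L ^ 2)).
  { apply Rdiv_lt_0_compat; [assumption|]. assert (0 < L ^ 2) by (apply pow_lt; lra). lra. }
  destruct (HP (mkposreal _ He)) as [d1 Hd1].
  destruct (HQ (mkposreal _ He)) as [d2 Hd2].
  simpl in Hd1, Hd2.
  assert (Hn : exists n, L / 2 ^ n < Rmin d1 d2).
  { destruct (pow_lt_1_zero (/ 2)) with (y := Rmin d1 d2 / L) as [N HN].
    - rewrite Rabs_pos_eq; lra.
    - apply Rdiv_lt_0_compat; [|assumption]. apply Rmin_pos; apply cond_pos.
    - exists N; specialize (HN N (le_n N)).
      rewrite Rabs_pos_eq in HN by (apply pow_le; lra).
      rewrite pow_inv in HN.
      apply Rmult_lt_compat_l with (r := L) in HN; [|assumption].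
      replace (L * (Rmin d1 d2 / L)) with (Rmin d1 d2) in HN by (field; lra).
      exact HN. }
  destruct Hn as [n Hn].
  destruct (Hz n) as [(B1 & B2 & B3 & B4 & B5) _].
  specialize (Hx0 n); specialize (Hy0 n); specialize (w0 n); specialize (h0 n).
  assert (p2 : 0 < 2 ^ n) by (apply pow_lt; lra).
  set (e := L / 2 ^ n) in *.
  assert (He0 : 0 < e) by (apply Rdiv_lt_0_compat; assumption).
  assert (Hwe : w n + h n < e).
  { unfold w, h, e, L; rewrite <- Rdiv_plus_distr.
    apply Rmult_lt_compat_r; [now apply Rinv_0_lt_compat|lra]. }
  assert (M1 := Rmin_l d1 d2); assert (M2 := Rmin_r d1 d2).
  assert (Hbound : Rabs (circ n (z n)) <=
    2 * ((fst (z n) + w n - fst (z n)) + (snd (z n) + h n - snd (z n)))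
      * (K / (4 * L ^ 2) * e)).
  { unfold circ; apply circulation_near_affine with x0 y0 p q s; try lra.
    - intros x y Hx Hy; apply closed; lra.
    - intros x y Hx Hy.
      assert (Rabs (x - x0) < e) by (apply Rabs_def1; lra).
      assert (Rabs (y - y0) < e) by (apply Rabs_def1; lra).
      assert (Hmax : K / (4 * L ^ 2) * Rmax (Rabs (x - x0)) (Rabs (y - y0))
                     <= K / (4 * L ^ 2) * e).
      { apply Rmult_le_compat_l; [lra|]. apply Rmax_lub; lra. }
      split; (eapply Rle_trans; [|exact Hmax]); [apply Hd1|apply Hd2]; lra. }
  assert (Hlt : Rabs (circ n (z n)) < K / 4 ^ n).
  { eapply Rle_lt_trans; [exact Hbound|].
    apply Rlt_le_trans with (2 * e * (K / (4 * L ^ 2) * e)).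
    - apply Rmult_lt_compat_r; [now apply Rmult_lt_0_compat|lra].
    - replace (4 ^ n) with (2 ^ n * 2 ^ n) by (rewrite <- Rpow_mult_distr; f_equal; lra).
      unfold e.
      replace (2 * (L / 2 ^ n) * (K / (4 * L ^ 2) * (L / 2 ^ n)))
        with (K / (2 ^ n * 2 ^ n) / 2) by (field; lra).
      assert (0 < K / (2 ^ n * 2 ^ n)).
      { apply Rdiv_lt_0_compat; [assumption|now apply Rmult_lt_0_compat]. }
      lra. }
  lra.
Qed.

End Goursat.

(** * Complex derivatives and the exponential *)

Notation C_deriv f z l := (is_derive (K := C_AbsRing) (V := C_NormedModule) f z l).
Notation C_differentiable f z := (ex_derive (K := C_AbsRing) (V := C_NormedModule) f z).

Lemma C_derive_iff (f : C -> C) (z l : C) :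
  C_deriv f z l <->
  forall eps : posreal, exists delta : posreal, forall u : C, Cmod (u - z) < delta ->
    Cmod (f u - f z - (u - z) * l) <= eps * Cmod (u - z).
Proof.
  split.
  - intros [_ H] eps.
    destruct (H z (fun P HP => HP) eps) as [delta Hd].
    exists delta; intros u Hu; exact (Hd u Hu).
  - intros H; split.
    + apply (is_linear_scal_l (K := C_AbsRing) (V := C_NormedModule)).
    + intros y Hy eps.
      (* The filter formulation admits any limit [y] of the neighbourhoods of [z]; separation forces
         [y = z]. *)
      apply (is_filter_lim_locally_unique (K := C_AbsRing) (V := AbsRing_NormedModule C_AbsRing)) in Hy.
      subst y; destruct (H eps) as [delta Hd].
      exists delta; intros u Hu; exact (Hd u Hu).
Qed.

Lemma Cmod_le_sum (z : C) : Cmod z <= Rabs (fst z) + Rabs (snd z).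
Proof.
  replace z with (RtoC (fst z) + Ci * RtoC (snd z))%C at 1
    by (destruct z; apply injective_projections; simpl; ring).
  eapply Rle_trans; [apply Cmod_triangle|].
  rewrite Cmod_mult, Cmod_Ci, !Cmod_R; lra.
Qed.

Lemma fst_le_Cmod (z : C) : Rabs (fst z) <= Cmod z.
Proof. exact (Rle_trans _ _ _ (Rmax_l _ _) (Rmax_Cmod z)). Qed.

Lemma snd_le_Cmod (z : C) : Rabs (snd z) <= Cmod z.
Proof. exact (Rle_trans _ _ _ (Rmax_r _ _) (Rmax_Cmod z)). Qed.

(** The real differential must be multiplication by [l]. The modulus and the maximum norm differ by
    a factor of at most 2, which explains the halved [eps] in both directions. *)
Lemma cauchy_riemann (f : C -> C) (x y : R) (l : C) :
  C_deriv f (x, y) l <->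
  differentiable_pt_lim (fun u v => fst (f (u, v))) x y (fst l) (- snd l) /\
  differentiable_pt_lim (fun u v => snd (f (u, v))) x y (snd l) (fst l).
Proof.
  rewrite C_derive_iff; split.
  - intros H.
    assert (HH : forall eps : posreal, locally_2d (fun u v =>
      Cmod (f (u, v) - f (x, y) - ((u, v) - (x, y)) * l)%C
        <= eps * Rmax (Rabs (u - x)) (Rabs (v - y))) x y).
    { intros eps.
      destruct (H (pos_div_2 eps)) as [d Hd].
      exists (pos_div_2 d); intros u v Hu Hv; simpl in *.
      set (z := ((u, v) - (x, y))%C).
      assert (Hz : Cmod z <= Rabs (u - x) + Rabs (v - y)) by apply (Cmod_le_sum z).
      assert (R1 := Rmax_l (Rabs (u - x)) (Rabs (v - y))).
      assert (R2 := Rmax_r (Rabs (u - x)) (Rabs (v - y))).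
      eapply Rle_trans; [apply Hd; fold z; lra|].
      fold z; assert (He := cond_pos eps).
      apply Rle_trans with (eps / 2 * (2 * Rmax (Rabs (u - x)) (Rabs (v - y)))); [|lra].
      apply Rmult_le_compat_l; lra. }
    split; intros eps; destruct (HH eps) as [d Hd]; exists d; intros u v Hu Hv;
      (eapply Rle_trans; [|apply Hd; assumption]).
    + eapply Rle_trans; [|apply fst_le_Cmod]; right; f_equal; simpl; ring.
    + eapply Rle_trans; [|apply snd_le_Cmod]; right; f_equal; simpl; ring.
  - intros [H1 H2] eps.
    destruct (H1 (pos_div_2 eps)) as [d1 Hd1].
    destruct (H2 (pos_div_2 eps)) as [d2 Hd2].
    exists (mkposreal _ (Rmin_pos _ _ (cond_pos d1) (cond_pos d2))).
    intros [u v] Hu; simpl in Hu.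
    assert (M1 := Rmin_l d1 d2); assert (M2 := Rmin_r d1 d2).
    assert (U1 := fst_le_Cmod ((u, v) - (x, y))%C); simpl fst in U1.
    assert (U2 := snd_le_Cmod ((u, v) - (x, y))%C); simpl snd in U2.
    unfold Rminus in *.
    assert (A1 := Hd1 u v ltac:(lra) ltac:(lra)).
    assert (A2 := Hd2 u v ltac:(lra) ltac:(lra)).
    simpl pos in *.
    assert (Hm := Rmax_lub _ _ _ U1 U2).
    eapply Rle_trans; [apply Cmod_le_sum|].
    apply Rle_trans with
      (eps / 2 * Rmax (Rabs (u + - x)) (Rabs (v + - y))
       + eps / 2 * Rmax (Rabs (u + - x)) (Rabs (v + - y))).
    + apply Rplus_le_compat; [eapply Rle_trans; [|exact A1]|eapply Rle_trans; [|exact A2]];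
        right; f_equal; simpl; ring.
    + assert (He := cond_pos eps).
      apply Rle_trans with (eps * Rmax (Rabs (u + - x)) (Rabs (v + - y))); [lra|].
      apply Rmult_le_compat_l; lra.
Qed.

(** * The complex exponential *)

Definition cexp (z : C) : C := (exp (fst z) * cos (snd z), exp (fst z) * sin (snd z)).

Lemma differentiable_pt_lim_Rmult (x y : R) :
  differentiable_pt_lim Rmult x y y x.
Proof.
  intros eps; exists eps; intros u v Hu Hv.
  replace (u * v - x * y - _) with ((u - x) * (v - y)) by ring.
  rewrite Rabs_mult.
  apply Rmult_le_compat; try apply Rabs_pos; [lra|apply Rmax_r].
Qed.

Lemma differentiable_pt_lim_snd (f : R -> R) (x y l : R) :
  derivable_pt_lim f y l -> differentiable_pt_lim (fun _ v => f v) x y 0 l.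
Proof.
  intros H.
  replace 0 with (l * 0 + 0 * 0) by ring.
  replace l with (l * 1 + 0 * 0) at 2 by ring.
  apply (differentiable_pt_lim_comp (fun u _ => f u) (fun _ v => v) (fun _ _ => 0)).
  - now apply differentiable_pt_lim_proj1_0.
  - intros eps; exists eps; intros u v _ _.
    replace (v - y - _) with 0 by ring; rewrite Rabs_R0.
    apply Rmult_le_pos; [apply Rlt_le, cond_pos|].
    eapply Rle_trans; [apply Rabs_pos|apply Rmax_l].
  - intros eps; exists eps; intros u v _ _.
    replace (0 - 0 - _) with 0 by ring; rewrite Rabs_R0.
    apply Rmult_le_pos; [apply Rlt_le, cond_pos|].
    eapply Rle_trans; [apply Rabs_pos|apply Rmax_l].
Qed.

Lemma is_derive_cexp (z : C) : C_deriv cexp z (cexp z).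
Proof.
  destruct z as [x y]; apply cauchy_riemann; unfold cexp; simpl; split.
  - replace (exp x * cos y) with (cos y * exp x + exp x * 0) by ring.
    replace (- (exp x * sin y)) with (cos y * 0 + exp x * - sin y) by ring.
    apply (differentiable_pt_lim_comp Rmult (fun u _ => exp u) (fun _ v => cos v)).
    + apply differentiable_pt_lim_Rmult.
    + apply differentiable_pt_lim_proj1_0, derivable_pt_lim_exp.
    + apply differentiable_pt_lim_snd, derivable_pt_lim_cos.
  - replace (exp x * sin y) with (sin y * exp x + exp x * 0) by ring.
    replace (exp x * cos y) with (sin y * 0 + exp x * cos y) by ring.
    apply (differentiable_pt_lim_comp Rmult (fun u _ => exp u) (fun _ v => sin v)).
    + apply differentiable_pt_lim_Rmult.
    + apply differentiable_pt_lim_proj1_0, derivable_pt_lim_exp.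
    + apply differentiable_pt_lim_snd, derivable_pt_lim_sin.
Qed.

Lemma Cmod_cexp (z : C) : Cmod (cexp z) = exp (fst z).
Proof.
  unfold Cmod, cexp; simpl fst; simpl snd.
  replace (_ + _) with (exp (fst z) ^ 2).
  - apply sqrt_pow2, Rlt_le, exp_pos.
  - assert (H := sin2_cos2 (snd z)); unfold Rsqr in H.
    transitivity (exp (fst z) ^ 2 * (sin (snd z) * sin (snd z) + cos (snd z) * cos (snd z)));
      [rewrite H|]; ring.
Qed.

Lemma cexp_plus (z u : C) : cexp (z + u) = (cexp z * cexp u)%C.
Proof.
  unfold cexp; simpl; rewrite exp_plus, cos_plus, sin_plus.
  apply injective_projections; simpl; ring.
Qed.

Lemma cexp_pow (z : C) (k : nat) : (cexp z ^ k)%C = cexp (RtoC (INR k) * z).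
Proof.
  induction k as [|k IH].
  - replace (RtoC (INR 0) * z)%C with (RtoC 0) by (simpl; ring).
    unfold cexp; simpl; rewrite exp_0, cos_0, sin_0.
    apply injective_projections; simpl; ring.
  - rewrite Cpow_S, IH, <- cexp_plus, S_INR; f_equal.
    apply injective_projections; simpl; ring.
Qed.

Lemma cexp_period (x : R) : cexp (x, 2 * PI) = cexp (x, 0).
Proof. unfold cexp; simpl; now rewrite cos_2PI, sin_2PI, cos_0, sin_0. Qed.

(** Together with [cexp_period] this gives [exp (- n u) h (exp u)] equal values on the two
    horizontal sides of a rectangle of height [2 * PI], as [vertical_integral_const] requires. *)
Lemma cexp_period_mult (x : R) (n : nat) :
  cexp (- RtoC (INR n) * (x, 2 * PI)) = cexp (- RtoC (INR n) * (x, 0)).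
Proof.
  unfold cexp; simpl.
  replace (- INR n * x - - 0 * (2 * PI)) with (- INR n * x - - 0 * 0) by ring.
  replace (- INR n * (2 * PI) + - 0 * x) with (- (0 + 2 * INR n * PI)) by ring.
  replace (- INR n * 0 + - 0 * x) with (- 0) by ring.
  now rewrite !cos_neg, !sin_neg, cos_period, sin_period.
Qed.

(** Coquelicot puts two normed-module structures on [C] over itself; they have the same
    norm but different uniform structures, so [is_derive] does not unify across them. *)
Lemma C_derive_AbsRing (f : C -> C) (z l : C) :
  C_deriv f z l <->
  is_derive (K := C_AbsRing) (V := AbsRing_NormedModule C_AbsRing) f z l.
Proof.
  split; intros [_ H]; split; try exact H.
  - apply (is_linear_scal_l (K := C_AbsRing) (V := AbsRing_NormedModule C_AbsRing)).
  - apply (is_linear_scal_l (K := C_AbsRing) (V := C_NormedModule)).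
Qed.

(** * Rules for complex differentiability *)

Lemma C_differentiable_mult (f g : C -> C) (z : C) :
  C_differentiable f z -> C_differentiable g z ->
  C_differentiable (fun u => (f u * g u)%C) z.
Proof.
  intros [df Hf%C_derive_AbsRing] [dg Hg%C_derive_AbsRing]; eexists; apply C_derive_AbsRing.
  apply (is_derive_mult (K := C_AbsRing) f g z df dg Hf Hg Cmult_comm).
Qed.

Lemma C_differentiable_comp (f g : C -> C) (z : C) :
  C_differentiable f (g z) -> C_differentiable g z -> C_differentiable (fun u => f (g u)) z.
Proof.
  intros [df Hf] [dg Hg%C_derive_AbsRing]; eexists.
  exact (is_derive_comp (K := C_AbsRing) (V := C_NormedModule) f g z df dg Hf Hg).
Qed.

Lemma C_differentiable_const (c z : C) : C_differentiable (fun _ => c) z.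
Proof. eexists; apply (is_derive_const (K := C_AbsRing) (V := C_NormedModule)). Qed.

Lemma C_differentiable_id (z : C) : C_differentiable (fun u => u) z.
Proof. eexists; apply C_derive_AbsRing, (is_derive_id (K := C_AbsRing)). Qed.

Lemma C_differentiable_pow (n : nat) (z : C) : C_differentiable (fun u => (u ^ n)%C) z.
Proof.
  induction n as [|n IH].
  - exact (C_differentiable_const 1 z).
  - apply (C_differentiable_mult (fun u => u) (fun u => (u ^ n)%C));
      [apply C_differentiable_id|exact IH].
Qed.

(** * Cauchy's estimate *)

(** A holomorphic function [u + i v] makes [v dx + u dy] closed. *)
Lemma vertical_integral_const (G : C -> C) (x0 x1 h : R) :
  x0 <= x1 -> 0 <= h ->
  (forall x y, x0 <= x <= x1 -> 0 <= y <= h -> C_differentiable G (x, y)) ->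
  (forall x, x0 <= x <= x1 -> G (x, h) = G (x, 0)) ->
  RInt (fun y => Re (G (x0, y))) 0 h = RInt (fun y => Re (G (x1, y))) 0 h.
Proof.
  intros Hx Hh HG Hper.
  assert (H := goursat_rectangle (fun x y => Im (G (x, y))) (fun x y => Re (G (x, y)))
    x0 x1 0 h Hx Hh).
  lapply H.
  - unfold circulation; intros E.
    (* By periodicity the two horizontal sides cancel, so zero circulation equates the vertical
       ones. *)
    rewrite (RInt_ext (V := R_CompleteNormedModule) (fun x => Im (G (x, h)))
      (fun x => Im (G (x, 0)))) in E.
    + lra.
    + intros x; rewrite Rmin_left, Rmax_right by lra; intros; rewrite Hper; [reflexivity|lra].
  - intros x y Hx' Hy'.
    destruct (HG x y Hx' Hy') as [l Hl].
    apply cauchy_riemann in Hl; destruct Hl as [H1 H2].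
    now exists (snd l), (fst l), (- snd l).
Qed.

Lemma continuous_Re_vertical (G : C -> C) (x y : R) :
  C_differentiable G (x, y) -> continuous (fun t => Re (G (x, t))) y.
Proof.
  intros [l Hl]; apply cauchy_riemann in Hl; destruct Hl as [H1 H2].
  now apply (differentiable_continuous_y (fun u v => Re (G (u, v))) x y) in H1.
Qed.

(** Orthogonality of the exponentials: the integrand is the real part of [c] times the exponential
    of [mu * (x, y)]. For [mu <> 0] it has an explicit antiderivative in [y], which is periodic
    because [mu] is an integer. *)
Lemma is_RInt_mode (c : C) (k n : nat) (x : R) :
  is_RInt (fun y => Re (c * (cexp (x, y) ^ k * cexp (- RtoC (INR n) * (x, y))))) 0 (2 * PI)
    (if Nat.eqb k n then 2 * PI * Re c else 0).
Proof.
  set (mu := INR k - INR n).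
  apply (is_RInt_ext (V := R_NormedModule)
    (fun y => exp (mu * x) * (Re c * cos (mu * y) - Im c * sin (mu * y)))).
  { intros y _; rewrite cexp_pow, <- cexp_plus.
    replace (RtoC (INR k) * (x, y) + - RtoC (INR n) * (x, y))%C with (mu * x, mu * y)
      by (unfold mu; apply injective_projections; simpl; ring).
    rewrite re_mult; unfold cexp, Re, Im; cbn [fst snd]; as_R; ring. }
  destruct (Nat.eqb_spec k n) as [->|Hkn].
  - apply (is_RInt_ext (V := R_NormedModule) (fun y => Re c)).
    { intros y _; unfold mu.
      replace ((INR n - INR n) * y) with 0 by ring; replace ((INR n - INR n) * x) with 0 by ring.
      rewrite exp_0, cos_0, sin_0; as_R; ring. }
    replace (2 * PI * Re c) with (scal (2 * PI - 0) (Re c))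
      by (unfold scal; simpl; unfold mult; simpl; ring).
    apply (is_RInt_const (V := R_NormedModule)).
  - assert (Hmu : mu <> 0).
    { unfold mu; intros H; apply Hkn, INR_eq; lra. }
    assert (Hcs : cos (mu * (2 * PI)) = 1 /\ sin (mu * (2 * PI)) = 0).
    { destruct (Nat.le_ge_cases n k) as [H|H].
      - unfold mu; rewrite <- minus_INR by assumption.
        replace (INR (k - n) * (2 * PI)) with (0 + 2 * INR (k - n) * PI) by ring.
        now rewrite cos_period, sin_period, cos_0, sin_0.
      - unfold mu; replace (INR k - INR n) with (- INR (n - k)) by (rewrite minus_INR; [ring|assumption]).
        replace (- INR (n - k) * (2 * PI)) with (- (0 + 2 * INR (n - k) * PI)) by ring.
        rewrite cos_neg, sin_neg, cos_period, sin_period, cos_0, sin_0; lra. }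
    set (F := fun y => exp (mu * x) * (Re c * sin (mu * y) + Im c * cos (mu * y)) / mu).
    replace 0 with (minus (F (2 * PI)) (F 0)) at 2.
    2: { unfold F, minus, plus, opp; simpl; destruct Hcs as [-> ->].
         rewrite (Rmult_0_r mu), sin_0, cos_0; field; assumption. }
    apply (is_RInt_derive (V := R_CompleteNormedModule)).
    + intros y _; unfold F; auto_derive; [exact I|field; assumption].
    + intros y _; apply (ex_derive_continuous (V := R_NormedModule)); auto_derive; exact I.
Qed.

Lemma is_RInt_modes (c : nat -> C) (n N : nat) (x : R) :
  is_RInt (fun y => Re (sum_n (fun k => c k * cexp (x, y) ^ k)%C N
                          * cexp (- RtoC (INR n) * (x, y)))) 0 (2 * PI)
    (if Nat.leb n N then 2 * PI * Re (c n) else 0).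
Proof.
  induction N as [|N IH].
  - apply (is_RInt_ext (V := R_NormedModule) (fun y =>
      Re (c 0%nat * (cexp (x, y) ^ 0 * cexp (- RtoC (INR n) * (x, y)))))).
    { intros y _; rewrite sum_O; f_equal; ring. }
    assert (H := is_RInt_mode (c 0%nat) 0 n x).
    destruct n; exact H.
  - apply (is_RInt_ext (V := R_NormedModule) (fun y => plus
      (Re (sum_n (fun k => c k * cexp (x, y) ^ k)%C N * cexp (- RtoC (INR n) * (x, y))))
      (Re (c (S N) * (cexp (x, y) ^ S N * cexp (- RtoC (INR n) * (x, y))))))).
    { intros y _; rewrite sum_Sn.
      eapply eq_trans; [symmetry; apply re_plus|f_equal].
      match goal with |- _ = (plus ?a ?b * ?d)%C => change (plus a b) with (a + b)%C end; ring. }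
    assert (E : (if Nat.leb n N then 2 * PI * Re (c n) else 0) +
                (if Nat.eqb (S N) n then 2 * PI * Re (c (S N)) else 0) =
                if Nat.leb n (S N) then 2 * PI * Re (c n) else 0).
    { destruct (Nat.leb_spec n N); destruct (Nat.eqb_spec (S N) n); destruct (Nat.leb_spec n (S N));
        try lia; subst; ring. }
    refine (eq_ind _ (is_RInt _ _ _) _ _ E).
    apply (is_RInt_plus (V := R_NormedModule)); [exact IH|apply is_RInt_mode].
Qed.

(** The approximating polynomial may have degree [N] beyond [n], since modes other than [n]
    integrate to zero. After multiplication by [exp (- n u)] the remainder of order [n + 1] is of
    size [K * t] on the circle of radius [t], and vanishes as [t] tends to 0. *)
Lemma cauchy_estimate_Re (H : C -> C) (r M K rho : R) (c : nat -> C) (n N : nat) :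
  0 < r -> 0 < rho -> (n <= N)%nat ->
  (forall z, Cmod z <= r -> C_differentiable H z) ->
  (forall y, 0 <= y <= 2 * PI -> Cmod (H (cexp (ln r, y))) <= M) ->
  (forall z, Cmod z <= rho ->
     Cmod (H z - sum_n (fun k => c k * z ^ k)%C N) <= K * Cmod z ^ S n) ->
  Rabs (Re (c n)) <= M / r ^ n.
Proof.
  intros Hr Hrho HnN Hd HM HK.
  set (G := fun u => (H (cexp u) * cexp (- RtoC (INR n) * u))%C).
  assert (HE : forall x y, Cmod (cexp (- RtoC (INR n) * (x, y))) = / exp x ^ n).
  { intros x y; rewrite Cmod_cexp; simpl.
    replace (- INR n * x - - 0 * y) with (- (INR n * x)) by ring.
    rewrite exp_Ropp; f_equal; clear; induction n as [|n IH].
    - simpl; rewrite Rmult_0_l; apply exp_0.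
    - rewrite S_INR, Rmult_plus_distr_r, Rmult_1_l, exp_plus, IH; simpl; ring. }
  assert (HG : forall x y, x <= ln r -> C_differentiable G (x, y)).
  { intros x y Hx; unfold G; apply C_differentiable_mult.
    - apply (C_differentiable_comp H cexp).
      + apply Hd; rewrite Cmod_cexp; simpl.
        rewrite <- (exp_ln r) by assumption.
        destruct Hx as [Hx|Hx]; [left; now apply exp_increasing|right; now rewrite Hx].
      + eexists; apply is_derive_cexp.
    - apply (C_differentiable_comp cexp (fun u => - RtoC (INR n) * u)%C).
      + eexists; apply is_derive_cexp.
      + apply (C_differentiable_mult (fun _ => - RtoC (INR n))%C (fun u => u)).
        * apply C_differentiable_const.
        * apply C_differentiable_id. }
  assert (HexG : forall x, x <= ln r -> ex_RInt (fun y => Re (G (x, y))) 0 (2 * PI)).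
  { intros x Hx; apply (ex_RInt_continuous (V := R_CompleteNormedModule)).
    intros y _; now apply continuous_Re_vertical, HG. }
  assert (Hpi := PI_RGT_0).
  assert (Hout : Rabs (RInt (fun y => Re (G (ln r, y))) 0 (2 * PI)) <= (2 * PI - 0) * (M / r ^ n)).
  { apply abs_RInt_le_const; [lra|apply HexG; lra|].
    intros y Hy; eapply Rle_trans; [apply re_le_Cmod|].
    unfold G; rewrite Cmod_mult, HE, exp_ln by assumption.
    apply Rmult_le_compat_r.
    - apply Rlt_le, Rinv_0_lt_compat, pow_lt; assumption.
    - now apply HM. }
  assert (Hin : forall t, 0 < t -> t <= r -> t <= rho ->
    2 * PI * Rabs (Re (c n)) <= 2 * PI * (M / r ^ n) + 2 * PI * (K * t)).
  { intros t Ht Htr Htrho.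
    assert (Hx : ln t <= ln r) by now apply ln_le.
    assert (Hconst := vertical_integral_const G (ln t) (ln r) (2 * PI) Hx ltac:(lra)).
    rewrite <- Hconst in Hout; clear Hconst.
    - assert (Hmodes := is_RInt_modes c n N (ln t)).
      apply Nat.leb_le in HnN; rewrite HnN in Hmodes.
      assert (Hdiff : Rabs (RInt (fun y => minus (Re (G (ln t, y)))
         (Re (sum_n (fun k => c k * cexp (ln t, y) ^ k)%C N
                          * cexp (- RtoC (INR n) * (ln t, y))))) 0 (2 * PI))
         <= (2 * PI - 0) * (K * t)).
      { apply abs_RInt_le_const; [lra| |].
        - apply (ex_RInt_minus (V := R_NormedModule)); [now apply HexG|now eexists; apply Hmodes].
        - intros y _; unfold G.
          match goal with |- Rabs (minus (Re ?a) (Re ?b)) <= _ =>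
            replace (minus (Re a) (Re b)) with (Re (a - b)) by reflexivity end.
          eapply Rle_trans; [apply re_le_Cmod|].
          match goal with |- Cmod (?a * ?b - ?d * ?b) <= _ =>
            replace (a * b - d * b)%C with ((a - d) * b)%C by ring end.
          rewrite Cmod_mult, HE, exp_ln by assumption.
          assert (tn : 0 < t ^ n) by now apply pow_lt.
          apply Rle_trans with (K * t ^ S n * / t ^ n).
          + apply Rmult_le_compat_r; [now apply Rlt_le, Rinv_0_lt_compat|].
            assert (Hm : Cmod (cexp (ln t, y)) = t) by (rewrite Cmod_cexp; now apply exp_ln).
            rewrite <- Hm at 2; apply HK; now rewrite Hm.
          + right; simpl; field; lra. }
      rewrite (RInt_minus (V := R_CompleteNormedModule)) in Hdiff;
        [|now apply HexG|now eexists; apply Hmodes].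
      rewrite (is_RInt_unique (V := R_CompleteNormedModule) _ _ _ _ Hmodes) in Hdiff.
      set (J := RInt (fun y => Re (G (ln t, y))) 0 (2 * PI)) in *.
      change (Rabs (J - 2 * PI * Re (c n)) <= (2 * PI - 0) * (K * t)) in Hdiff.
      rewrite <- (Rabs_pos_eq (2 * PI)) at 1 by lra.
      rewrite <- Rabs_mult.
      replace (2 * PI * Re (c n)) with (J - (J - 2 * PI * Re (c n))) by ring.
      eapply Rle_trans; [apply Rabs_triang|]; rewrite Rabs_Ropp; lra.
    - intros x y Hx' _; apply HG; lra.
    - intros x _; unfold G; now rewrite cexp_period, cexp_period_mult. }
  destruct (Rle_dec (Rabs (Re (c n))) (M / r ^ n)) as [|Hlt]; [assumption|exfalso].
  apply Rnot_le_lt in Hlt.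
  set (e := Rabs (Re (c n)) - M / r ^ n) in *.
  assert (He : 0 < e) by (unfold e; lra).
  assert (HK1 : 0 < Rabs K + 1) by (assert (X := Rabs_pos K); lra).
  (* Small enough that [K * t] uses only half of the supposed excess [e]. The sign of [K] is
     unknown, hence the divisor [Rabs K + 1]. *)
  set (t := Rmin (Rmin r rho) (e / 2 / (Rabs K + 1))).
  assert (Ht : 0 < t).
  { unfold t; repeat apply Rmin_pos; try assumption. apply Rdiv_lt_0_compat; lra. }
  assert (T1 := Rmin_l (Rmin r rho) (e / 2 / (Rabs K + 1))).
  assert (T2 := Rmin_r (Rmin r rho) (e / 2 / (Rabs K + 1))).
  assert (T3 := Rmin_l r rho); assert (T4 := Rmin_r r rho).
  fold t in T1, T2.
  specialize (Hin t Ht ltac:(lra) ltac:(lra)).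
  assert (HKt : K * t <= e / 2).
  { apply Rle_trans with ((Rabs K + 1) * (e / 2 / (Rabs K + 1))).
    - apply Rle_trans with ((Rabs K + 1) * t).
      + apply Rmult_le_compat_r; [lra|]. assert (X := Rle_abs K); lra.
      + apply Rmult_le_compat_l; lra.
    - right; field; lra. }
  unfold e in *; nra.
Qed.

(** [M] bounds [H] on the circle of radius [r], by compactness. It is chosen before [c], [n] and
    [N], so one constant serves a different approximating polynomial for every [n]. *)
Lemma cauchy_estimate (H : C -> C) (r : R) :
  0 < r -> (forall z, Cmod z <= r -> C_differentiable H z) ->
  exists M, forall (c : nat -> C) (n N : nat) (K rho : R), 0 < rho -> (n <= N)%nat ->
    (forall z, Cmod z <= rho ->
       Cmod (H z - sum_n (fun k => c k * z ^ k)%C N) <= K * Cmod z ^ S n) ->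
    Cmod (c n) <= M / r ^ n.
Proof.
  intros Hr Hd.
  set (F := fun u => H (cexp u)).
  assert (HF : forall y, C_differentiable F (ln r, y)).
  { intros y; apply (C_differentiable_comp H cexp).
    - apply Hd; rewrite Cmod_cexp; simpl; rewrite exp_ln; lra.
    - eexists; apply is_derive_cexp. }
  destruct (bounded_continuity (V := R_NormedModule) (fun y => fst (F (ln r, y))) 0 (2 * PI)) as [M1 HM1].
  { intros y _; destruct (HF y) as [l Hl%cauchy_riemann].
    exact (differentiable_continuous_y (fun u v => fst (F (u, v))) _ _ _ _ (proj1 Hl)). }
  destruct (bounded_continuity (V := R_NormedModule) (fun y => snd (F (ln r, y))) 0 (2 * PI)) as [M2 HM2].
  { intros y _; destruct (HF y) as [l Hl%cauchy_riemann].
    exact (differentiable_continuous_y (fun u v => snd (F (u, v))) _ _ _ _ (proj2 Hl)). }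
  assert (HM : forall y, 0 <= y <= 2 * PI -> Cmod (F (ln r, y)) <= M1 + M2).
  { intros y Hy; eapply Rle_trans; [apply Cmod_le_sum|].
    apply Rplus_le_compat; apply Rlt_le; [now apply HM1|now apply HM2]. }
  exists (M1 + M2); intros c n N K rho Hrho HnN HK.
  assert (Hrn : 0 < r ^ n) by now apply pow_lt.
  destruct (Rle_lt_or_eq_dec 0 (Cmod (c n)) (Cmod_ge_0 _)) as [Hc|Hc].
  2: { rewrite <- Hc; apply Rdiv_le_0_compat; [|assumption].
       eapply Rle_trans; [apply Cmod_ge_0|apply (HM 0)]; assert (X := PI_RGT_0); lra. }
  (* Multiply by the conjugate of [c n]: its product with [c n] is real. *)
  assert (HRe := cauchy_estimate_Re (fun z => H z * Cconj (c n))%C r ((M1 + M2) * Cmod (c n))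
    (K * Cmod (c n)) rho (fun k => c k * Cconj (c n))%C n N Hr Hrho HnN).
  assert (E : Re (c n * Cconj (c n)) = Cmod (c n) * Cmod (c n)).
  { rewrite <- Cmod2_conj; simpl; ring. }
  cbv beta in HRe; rewrite E in HRe; clear E.
  apply Rmult_le_reg_r with (Cmod (c n)); [assumption|].
  eapply Rle_trans; [apply Rle_abs|]; eapply Rle_trans; [apply HRe|].
  - intros z Hz; apply (C_differentiable_mult H (fun _ => Cconj (c n))); [now apply Hd|].
    apply C_differentiable_const.
  - intros y Hy; rewrite Cmod_mult, Cmod_conj.
    apply Rmult_le_compat_r; [lra|now apply HM].
  - intros z Hz.
    rewrite (sum_n_ext (G := C_AbelianMonoid) _ (fun k => mult (K := C_Ring) (c k * z ^ k)%C (Cconj (c n))))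
      by (intros k; change (c k * Cconj (c n) * z ^ k = c k * z ^ k * Cconj (c n))%C; ring).
    rewrite (sum_n_mult_r (K := C_Ring)).
    match goal with |- Cmod (?a * ?b - mult ?d ?b) <= _ =>
      replace (a * b - mult d b)%C with ((a - d) * b)%C by (change (mult d b) with (d * b)%C; ring) end.
    rewrite Cmod_mult, Cmod_conj.
    apply Rle_trans with (K * Cmod z ^ S n * Cmod (c n)); [|right; ring].
    apply Rmult_le_compat_r; [lra|now apply HK].
  - right; field; lra.
Qed.

(** * Complex power series *)

Notation is_C_series u l := (is_series (K := C_AbsRing) (V := C_NormedModule) u l).

Lemma C_pow_n (z : C) (n : nat) : pow_n (K := C_Ring) z n = (z ^ n)%C.
Proof. induction n as [|n IH]; [reflexivity|simpl; now rewrite IH]. Qed.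

Lemma is_C_pseries (a : nat -> C) (z l : C) :
  is_pseries (K := C_AbsRing) (V := C_NormedModule) a z l <->
  is_C_series (fun n => a n * z ^ n)%C l.
Proof.
  assert (E : forall n, (pow_n (K := C_Ring) z n * a n = a n * z ^ n)%C).
  { intros n; rewrite C_pow_n; apply Cmult_comm. }
  split; apply is_series_ext; intros n; [|symmetry]; apply E.
Qed.

Lemma C_series_le (u : nat -> C) (v : nat -> R) (l : C) (s : R) :
  (forall n, Cmod (u n) <= v n) -> is_C_series u l -> is_series v s -> Cmod l <= s.
Proof.
  intros Huv Hu Hv.
  apply (is_lim_seq_le (fun n => Cmod (sum_n u n)) (sum_n v) (Cmod l) s).
  - intros n.
    eapply Rle_trans; [apply (norm_sum_n_m (V := C_NormedModule))|].
    apply sum_n_m_le; intros k; apply Huv.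
  - exact (filterlim_comp _ _ _ _ _ _ _ _ Hu (filterlim_norm (V := C_NormedModule) l)).
  - exact Hv.
Qed.

Lemma ex_C_series_le (u : nat -> C) (v : nat -> R) :
  (forall n, Cmod (u n) <= v n) -> ex_series v -> exists l, is_C_series u l.
Proof. exact (ex_series_le (V := C_CompleteNormedModule) u v). Qed.

(** At the midpoint of [x] and [r] the series converges, so its partial sums are bounded by some [M]
    and its terms, being differences of partial sums, by [M + M]. Bounded terms there put the radius
    of the series of moduli beyond [x]. *)
Lemma CV_radius_Cmod (a : nat -> C) (r : R) :
  (forall z, Cmod z < r -> ex_pseries (K := C_AbsRing) (V := C_NormedModule) a z) ->
  forall x, 0 <= x < r -> Rbar_lt (Rabs x) (CV_radius (fun n => Cmod (a n))).
Proof.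
  intros Ha x Hx.
  apply Rbar_lt_le_trans with (Finite ((x + r) / 2)); [simpl; rewrite Rabs_pos_eq; lra|].
  apply (CV_radius_bounded (fun n => Cmod (a n))).
  destruct (Ha (RtoC ((x + r) / 2))) as [l Hl].
  { rewrite Cmod_R, Rabs_pos_eq; lra. }
  assert (Hl' := proj1 (is_C_pseries _ _ _) Hl); clear Hl.
  destruct (filterlim_bounded (V := C_NormedModule) (sum_n (fun n => a n * RtoC ((x + r) / 2) ^ n)%C)) as [M HM].
  { exists l; exact Hl'. }
  exists (M + M); intros n.
  rewrite Rabs_mult, (Rabs_pos_eq (Cmod _)), <- RPow_abs by apply Cmod_ge_0.
  rewrite <- Cmod_R, <- Cmod_pow, <- Cmod_mult.
  destruct n as [|n].
  - specialize (HM 0%nat); rewrite sum_O in HM.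
    assert (X := Cmod_ge_0 (a 0%nat * RtoC ((x + r) / 2) ^ 0)).
    change (norm ?z) with (Cmod z) in HM; lra.
  - assert (H1 := HM n); assert (H2 := HM (S n)); rewrite sum_Sn in H2.
    change (norm ?z) with (Cmod z) in H1, H2.
    change (plus ?z ?u) with (z + u)%C in H2.
    match type of H2 with Cmod (?s + ?t) <= _ => replace t with ((s + t) - s)%C by ring end.
    eapply Rle_trans; [apply Cmod_triangle|]; rewrite Cmod_opp; lra.
Qed.

Lemma ex_series_Cmod_of_lt (a : nat -> C) (f : C -> C) (r s : R) :
  (forall z : C, Cmod z < r -> is_pseries (K := C_AbsRing) (V := C_NormedModule) a z (f z)) ->
  0 <= s < r -> ex_series (fun j => Cmod (a j) * s ^ j).
Proof.
  intros Hf Hs.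
  refine (proj1 (ex_pseries_R (fun j => Cmod (a j)) s) (CV_radius_inside _ _ _)).
  apply (CV_radius_Cmod a r); [|assumption].
  intros z Hz; exists (f z); now apply Hf.
Qed.

(** Second-order Taylor remainder of [z ^ n]: its modulus is at most the same expression
    at [Cmod z], [Cmod h], which reduces complex power series to real ones. *)
Lemma Cmod_pow_remainder (z h : C) (n : nat) :
  Cmod ((z + h) ^ n - z ^ n - RtoC (INR n) * z ^ Nat.pred n * h) <=
  (Cmod z + Cmod h) ^ n - Cmod z ^ n - INR n * Cmod z ^ Nat.pred n * Cmod h.
Proof.
  induction n as [|n IH].
  - simpl; replace (1 - 1 - 0 * 1 * h)%C with (RtoC 0) by ring; rewrite Cmod_0; lra.
    assert (EC : ((z + h) ^ S n - z ^ S n - RtoC (INR (S n)) * z ^ Nat.pred (S n) * h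
      = (z + h) * ((z + h) ^ n - z ^ n - RtoC (INR n) * z ^ Nat.pred n * h)
        + RtoC (INR n) * z ^ Nat.pred n * (h * h))%C).
    { rewrite S_INR, RtoC_plus; destruct n as [|n]; simpl Nat.pred; rewrite ?Cpow_S; [simpl|]; ring. }
    assert (ER : (Cmod z + Cmod h) ^ S n - Cmod z ^ S n - INR (S n) * Cmod z ^ Nat.pred (S n) * Cmod h
      = (Cmod z + Cmod h) * ((Cmod z + Cmod h) ^ n - Cmod z ^ n - INR n * Cmod z ^ Nat.pred n * Cmod h)
        + INR n * Cmod z ^ Nat.pred n * (Cmod h * Cmod h)).
    { rewrite S_INR; destruct n as [|n]; simpl Nat.pred; rewrite <- ?tech_pow_Rmult; [simpl|]; ring. }
    rewrite EC, ER.
    eapply Rle_trans; [apply Cmod_triangle|].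
    apply Rplus_le_compat.
    + rewrite Cmod_mult; apply Rmult_le_compat; try apply Cmod_ge_0; [apply Cmod_triangle|exact IH].
    + right; rewrite !Cmod_mult, Cmod_pow, Cmod_R, Rabs_pos_eq by apply pos_INR; ring.
Qed.

(** The derivative [D] is the termwise one. By [Cmod_pow_remainder] its remainder at [z + h] is
    dominated term by term by the Taylor remainder of the real series [PSeries b] from [Cmod z] to
    [Cmod z + Cmod h], and that series is differentiable. *)
Lemma C_differentiable_pseries (a : nat -> C) (f : C -> C) (r : R) :
  (forall z, Cmod z < r -> is_pseries (K := C_AbsRing) (V := C_NormedModule) a z (f z)) ->
  forall z, Cmod z < r -> C_differentiable f z.
Proof.
  intros Hf z Hz.
  set (b := fun n => Cmod (a n)).
  assert (Hb : forall x, 0 <= x < r -> Rbar_lt (Rabs x) (CV_radius b)).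
  { apply CV_radius_Cmod; intros u Hu; exists (f u); now apply Hf. }
  assert (Hx := Cmod_ge_0 z); set (x := Cmod z) in *.
  assert (HB : forall y, 0 <= y < r -> is_series (fun n => b n * y ^ n) (PSeries b y)).
  { intros y Hy; exact (proj1 (is_pseries_R b y _)
      (PSeries_correct b y (CV_radius_inside b y (Hb y Hy)))). }
  (* The term of index 0 vanishes, which absorbs the index shift of [PS_derive]. *)
  assert (HB' : is_series (fun n => b n * (INR n * x ^ Nat.pred n)) (PSeries (PS_derive b) x)).
  { apply (is_series_decr_1 (V := R_NormedModule)).
    assert (H := proj1 (is_pseries_R _ _ _)
      (PSeries_correct _ _ (ex_pseries_derive b x (Hb x ltac:(lra))))).
    replace (plus _ _) with (PSeries (PS_derive b) x).
    2: { unfold plus, opp; simpl; as_R; ring. }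
    revert H; apply is_series_ext; intros n; unfold PS_derive; simpl Nat.pred; as_R; ring. }
  assert (HD : exists D, is_C_series (fun n => a n * (RtoC (INR n) * z ^ Nat.pred n))%C D).
  { apply ex_C_series_le with (fun n => b n * (INR n * x ^ Nat.pred n)).
    - intros n; right; rewrite !Cmod_mult, Cmod_pow, Cmod_R, Rabs_pos_eq by apply pos_INR; reflexivity.
    - eexists; exact HB'. }
  destruct HD as [D HD]; exists D; apply C_derive_iff; intros eps.
  assert (Hder := is_derive_PSeries b x (Hb x ltac:(lra))).
  apply is_derive_Reals in Hder.
  destruct (Hder eps (cond_pos eps)) as [delta Hdelta].
  assert (Hrx : 0 < r - x) by lra.
  exists (mkposreal _ (Rmin_pos _ _ (cond_pos delta) Hrx)); simpl; intros u Hu.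
  assert (M1 := Rmin_l delta (r - x)); assert (M2 := Rmin_r delta (r - x)).
  set (h := (u - z)%C) in *.
  replace u with (z + h)%C by (unfold h; ring).
  assert (Hk := Cmod_ge_0 h).
  destruct (Rle_lt_or_eq_dec _ _ Hk) as [Hk'|Hk'].
  2: { rewrite (Cmod_eq_0 h) by auto.
       replace (z + 0)%C with z by ring.
       replace (f z - f z - 0 * D)%C with (RtoC 0) by ring; rewrite Cmod_0; lra. }
  apply Rle_trans with (PSeries b (x + Cmod h) - PSeries b x - Cmod h * PSeries (PS_derive b) x).
  - apply C_series_le with
      (fun n => a n * ((z + h) ^ n - z ^ n - RtoC (INR n) * z ^ Nat.pred n * h))%C
      (fun n => b n * ((x + Cmod h) ^ n - x ^ n - INR n * x ^ Nat.pred n * Cmod h)).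
    + intros n; rewrite Cmod_mult; apply Rmult_le_compat_l; [apply Cmod_ge_0|].
      apply Cmod_pow_remainder.
    + assert (Hzh : Cmod (z + h) < r).
      { eapply Rle_lt_trans; [apply Cmod_triangle|]. fold x; lra. }
      assert (S1 := proj1 (is_C_pseries _ _ _) (Hf _ Hzh)).
      assert (S2 := proj1 (is_C_pseries _ _ _) (Hf _ Hz)).
      assert (S3 := is_series_scal (V := C_NormedModule) h _ _ HD).
      generalize (is_series_minus (V := C_NormedModule) _ _ _ _
        (is_series_minus (V := C_NormedModule) _ _ _ _ S1 S2) S3).
      apply is_series_ext; intros n.
      match goal with |- plus (plus ?p (opp ?q)) (opp (scal h ?s)) = _ =>
        change ((p - q - h * s)%C = a n * ((z + h) ^ n - z ^ n - RtoC (INR n) * z ^ Nat.pred n * h))%C end.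
      ring.
    + assert (S1 := HB (x + Cmod h) ltac:(lra)).
      assert (S2 := HB x ltac:(lra)).
      assert (S3 := is_series_scal (V := R_NormedModule) (Cmod h) _ _ HB').
      generalize (is_series_minus (V := R_NormedModule) _ _ _ _
        (is_series_minus (V := R_NormedModule) _ _ _ _ S1 S2) S3).
      apply is_series_ext; intros n.
      unfold plus, opp, scal; simpl; unfold mult; simpl; as_R; ring.
  - assert (H := Hdelta (Cmod h) ltac:(lra)); rewrite Rabs_pos_eq in H by lra.
    specialize (H ltac:(lra)).
    apply Rabs_def2 in H; destruct H as [H _].
    apply Rmult_lt_compat_r with (r := Cmod h) in H; [|assumption].
    rewrite Rmult_minus_distr_r in H.
    replace ((PSeries b (x + Cmod h) - PSeries b x) / Cmod h * Cmod h)
      with (PSeries b (x + Cmod h) - PSeries b x) in H by (field; lra).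
    lra.
Qed.

(** Factor [z ^ S n] out of the tail; what is left is bounded on [Cmod z <= s] by the sum [K] of
    [Cmod (a (S n + j)) * s ^ j]. *)
Lemma pseries_tail_bound (a : nat -> C) (f : C -> C) (r s : R) (n : nat) :
  (forall z, Cmod z < r -> is_pseries (K := C_AbsRing) (V := C_NormedModule) a z (f z)) ->
  0 < s < r ->
  exists K, 0 <= K /\ forall z, Cmod z <= s ->
    Cmod (f z - sum_n (fun j => a j * z ^ j)%C n) <= K * Cmod z ^ S n.
Proof.
  intros Hf Hs.
  assert (Hb := ex_series_Cmod_of_lt a f r s Hf ltac:(lra)).
  assert (Hconv : ex_series (fun j => Cmod (a (S n + j)%nat) * s ^ j)).
  { apply (ex_series_incr_n (V := R_NormedModule) _ (S n)) in Hb.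
    apply (ex_series_scal (V := R_NormedModule) (/ s ^ S n)) in Hb.
    revert Hb; apply ex_series_ext; intros j; unfold scal; simpl; unfold mult; simpl.
    assert (0 < s ^ n) by (apply pow_lt; lra).
    rewrite pow_add; as_R; field; lra. }
  destruct Hconv as [K HK]; exists K; split.
  { apply (is_lim_seq_le (fun _ => 0) (sum_n (fun j => Cmod (a (S n + j)%nat) * s ^ j)) 0 K).
    - intros m; apply Rle_trans with (sum_n (fun _ => 0) m).
      { rewrite sum_n_const, Rmult_0_r; apply Rle_refl. }
      apply sum_n_m_le; intros k; apply Rmult_le_pos; [apply Cmod_ge_0|apply pow_le; lra].
    - apply is_lim_seq_const.
    - exact HK. }
  intros z Hz.
  apply C_series_le with (fun j => a (S n + j)%nat * z ^ (S n + j))%C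
    (fun j => Cmod (a (S n + j)%nat) * s ^ j * Cmod z ^ S n).
  - intros j; rewrite Cmod_mult, Cmod_pow, pow_add.
    rewrite Rmult_assoc, (Rmult_comm (s ^ j)).
    apply Rmult_le_compat_l; [apply Cmod_ge_0|].
    apply Rmult_le_compat_l; [apply pow_le, Cmod_ge_0|].
    apply pow_incr; split; [apply Cmod_ge_0|assumption].
  - apply (is_series_incr_n (V := C_NormedModule) (fun j => a j * z ^ j)%C (S n)); [lia|].
    simpl Nat.pred.
    refine (eq_ind (f z) (fun l => is_C_series _ l) (proj1 (is_C_pseries a z (f z)) _) _ _).
    + apply Hf; lra.
    + match goal with |- _ = plus ?p ?q => change (f z = f z - q + q)%C end; ring.
  - apply (is_series_ext (fun j => scal (Cmod z ^ S n) (Cmod (a (S n + j)%nat) * s ^ j))).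
    + intros j; unfold scal; simpl; unfold mult; simpl; as_R; ring.
    + replace (K * Cmod z ^ S n) with (scal (Cmod z ^ S n) K)
        by (unfold scal; simpl; unfold mult; simpl; ring).
      now apply (is_series_scal (V := R_NormedModule)).
Qed.

(** * Hadamard's substitution and its coefficients *)

Lemma sum_n_Rmult_l (c : R) (u : nat -> R) (N : nat) :
  sum_n (fun k => c * u k) N = c * sum_n u N.
Proof. exact (sum_n_mult_l (K := R_Ring) c u N). Qed.

Lemma sum_n_zero (u : nat -> R) (N : nat) :
  (forall j, (j <= N)%nat -> u j = 0) -> sum_n u N = 0.
Proof.
  intros Hu.
  rewrite (sum_n_ext_loc u (fun _ => 0)) by exact Hu.
  now rewrite sum_n_const, Rmult_0_r.
Qed.

Lemma sum_n_single (u : nat -> R) (N i : nat) :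
  (i <= N)%nat -> (forall j, j <> i -> u j = 0) -> sum_n u N = u i.
Proof.
  intros Hi Hu; induction N as [|N IH].
  - now replace i with 0%nat by lia; rewrite sum_O.
  - rewrite sum_Sn; change (plus ?x ?y) with (x + y).
    destruct (Nat.eq_dec i (S N)) as [->|Hne].
    + rewrite sum_n_zero; [as_R; ring|]. intros j Hj; apply Hu; lia.
    + rewrite IH, (Hu (S N)) by lia; as_R; ring.
Qed.

Lemma sum_n_le_loc (u v : nat -> R) (N : nat) :
  (forall j, (j <= N)%nat -> u j <= v j) -> sum_n u N <= sum_n v N.
Proof.
  intros H; induction N as [|N IH].
  - rewrite !sum_O; apply H; lia.
  - rewrite !sum_Sn; apply Rplus_le_compat; [apply IH; intros; apply H|apply H]; lia.
Qed.

Lemma sum_n_nonneg (u : nat -> R) (N : nat) : (forall j, 0 <= u j) -> 0 <= sum_n u N.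
Proof.
  intros H; rewrite <- (sum_n_zero (fun _ => 0) N) by reflexivity.
  apply sum_n_le_loc; intros; apply H.
Qed.

Lemma sum_n_mono (u : nat -> R) (M N : nat) :
  (forall j, 0 <= u j) -> (M <= N)%nat -> sum_n u M <= sum_n u N.
Proof.
  intros Hu HMN; induction HMN as [|N _ IH]; [lra|].
  rewrite sum_Sn; change (plus ?x ?y) with (x + y); specialize (Hu (S N)); lra.
Qed.

Lemma ex_series_of_bounded (u : nat -> R) (B : R) :
  (forall j, 0 <= u j) -> (forall N, sum_n u N <= B) -> ex_series u.
Proof.
  intros Hu HB.
  destruct (ex_finite_lim_seq_incr (sum_n u) B) as [l Hl]; [|exact HB|now exists l].
  intros n; apply sum_n_mono; [exact Hu|lia].
Qed.

Lemma sum_n_le_series (u : nat -> R) :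
  (forall j, 0 <= u j) -> ex_series u -> exists B, forall N, sum_n u N <= B.
Proof.
  intros Hu [l Hl]; exists l; intros N.
  apply (is_lim_seq_le_loc (fun _ => sum_n u N) (sum_n u) (sum_n u N) l).
  - exists N; intros n Hn; now apply sum_n_mono.
  - apply is_lim_seq_const.
  - exact Hl.
Qed.

Lemma RtoC_sum_n (u : nat -> R) (N : nat) :
  RtoC (sum_n u N) = sum_n (fun k => RtoC (u k)) N.
Proof.
  induction N as [|N IH]; [now rewrite !sum_O|].
  rewrite !sum_Sn, <- IH; apply RtoC_plus.
Qed.

(** * Coefficients of the powers of Hadamard's polynomial *)

Definition shift (k : nat) (u : nat -> R) (n : nat) : R :=
  if Nat.leb k n then u (n - k)%nat else 0.

(** [hadamard_coeff p j n] is the coefficient of [x ^ n] in [((x ^ p + x ^ S p) / 2) ^ j]. *)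
Fixpoint hadamard_coeff (p j : nat) : nat -> R :=
  match j with
  | O => fun n => if Nat.eqb n 0 then 1 else 0
  | S j => fun n => (shift p (hadamard_coeff p j) n + shift (S p) (hadamard_coeff p j) n) / 2
  end.

Lemma hadamard_coeff_nonneg (p j n : nat) : 0 <= hadamard_coeff p j n.
Proof.
  revert n; induction j as [|j IH]; intros n; simpl.
  - destruct (Nat.eqb n 0); lra.
  - assert (Hs : forall k, 0 <= shift k (hadamard_coeff p j) n).
    { intros k; unfold shift; destruct (Nat.leb k n); [apply IH|lra]. }
    assert (H1 := Hs p); assert (H2 := Hs (S p)); lra.
Qed.

(** Each of the [j] factors contributes an exponent [p] or [S p]. *)
Lemma hadamard_coeff_support (p j n : nat) :
  hadamard_coeff p j n <> 0 -> (p * j <= n <= S p * j)%nat.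
Proof.
  revert n; induction j as [|j IH]; intros n; simpl hadamard_coeff.
  - destruct (Nat.eqb_spec n 0); [lia|lra].
  - intros H.
    assert (Hs : shift p (hadamard_coeff p j) n <> 0 \/ shift (S p) (hadamard_coeff p j) n <> 0).
    { apply NNPP; intros Hn; apply H.
      apply not_or_and in Hn; destruct Hn as [H1%NNPP H2%NNPP]; rewrite H1, H2; lra. }
    unfold shift in Hs; destruct Hs as [Hs|Hs].
    + destruct (Nat.leb_spec p n); [|lra]. apply IH in Hs; nia.
    + destruct (Nat.leb_spec (S p) n); [|lra]. apply IH in Hs; nia.
Qed.

Lemma sum_n_shift (u : nat -> R) (x : C) (k m : nat) :
  sum_n (fun n => shift k u n * x ^ n)%C (k + m) = (x ^ k * sum_n (fun n => u n * x ^ n)%C m)%C.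
Proof.
  assert (Hlow : forall N, (N < k)%nat -> sum_n (fun n => shift k u n * x ^ n)%C N = RtoC 0).
  { assert (Hs : forall n, (n < k)%nat -> shift k u n = 0).
    { intros n Hn; unfold shift; destruct (Nat.leb_spec k n); [lia|reflexivity]. }
    intros N; induction N as [|N IH]; intros HN.
    - rewrite sum_O, Hs by assumption; as_C; ring.
    - rewrite sum_Sn, IH, Hs by lia; as_C; ring. }
  induction m as [|m IH].
  - rewrite Nat.add_0_r, sum_O.
    assert (Hk : shift k u k = u 0%nat).
    { unfold shift; rewrite Nat.leb_refl, Nat.sub_diag; reflexivity. }
    destruct k as [|k]; [rewrite sum_O|rewrite sum_Sn, Hlow by lia]; rewrite Hk.
    + simpl; ring.
    + as_C; simpl; ring.
  - rewrite Nat.add_succ_r, !sum_Sn, IH.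
    assert (Hk : shift k u (S (k + m)) = u (S m)).
    { unfold shift; destruct (Nat.leb_spec k (S (k + m))); [f_equal; lia|lia]. }
    rewrite Hk, <- Nat.add_succ_r, Cpow_add_r.
    as_C; ring.
Qed.

(** The degree is [S p * j], so the truncation at [N] keeps the entire polynomial. *)
Lemma hadamard_coeff_sum (p j N : nat) (x : C) :
  (S p * j <= N)%nat ->
  sum_n (fun n => hadamard_coeff p j n * x ^ n)%C N = (((x ^ p + x ^ S p) / 2) ^ j)%C.
Proof.
  revert N; induction j as [|j IH]; intros N HN.
  - induction N as [|N IHN].
    + rewrite sum_O; as_C; simpl; ring.
    + rewrite sum_Sn, IHN by lia.
      as_C; simpl; ring.
  - assert (E1 : sum_n (fun n => shift p (hadamard_coeff p j) n * x ^ n)%C N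
                 = (x ^ p * ((x ^ p + x ^ S p) / 2) ^ j)%C).
    { replace N with (p + (N - p))%nat by nia; rewrite sum_n_shift, IH; [reflexivity|nia]. }
    assert (E2 : sum_n (fun n => shift (S p) (hadamard_coeff p j) n * x ^ n)%C N
                 = (x ^ S p * ((x ^ p + x ^ S p) / 2) ^ j)%C).
    { replace N with (S p + (N - S p))%nat by nia; rewrite sum_n_shift, IH; [reflexivity|nia]. }
    rewrite Cpow_S.
    transitivity ((/ 2) * (sum_n (fun n => shift p (hadamard_coeff p j) n * x ^ n)%C N
                  + sum_n (fun n => shift (S p) (hadamard_coeff p j) n * x ^ n)%C N))%C.
    2: { rewrite E1, E2; as_C; unfold Cdiv; ring. }
    eapply eq_trans;
      [|exact (f_equal (mult (K := C_Ring) (/ 2)%C) (sum_n_plus (G := C_AbelianMonoid) _ _ N))].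
    eapply eq_trans; [|apply (sum_n_mult_l (K := C_Ring))].
    apply sum_n_ext; intros n; simpl hadamard_coeff.
    match goal with |- ?a = @mult _ ?b (@plus _ ?c ?d) => change (a = b * (c + d))%C end.
    rewrite RtoC_div, RtoC_plus by lra; as_C; unfold Cdiv; ring.
Qed.

Lemma hadamard_coeff_sum_R (p j N : nat) (x : R) :
  (S p * j <= N)%nat ->
  sum_n (fun n => hadamard_coeff p j n * x ^ n) N = ((x ^ p + x ^ S p) / 2) ^ j.
Proof.
  intros HN; apply RtoC_inj; rewrite RtoC_sum_n.
  rewrite (sum_n_ext _ (fun n => hadamard_coeff p j n * RtoC x ^ n)%C)
    by (intros n; now rewrite RtoC_mult, RtoC_pow).
  rewrite hadamard_coeff_sum by assumption.
  now rewrite RtoC_pow, RtoC_div, RtoC_plus, !RtoC_pow by lra.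
Qed.

Lemma hadamard_coeff_sum_le (p j N : nat) (x : R) :
  0 <= x -> sum_n (fun n => hadamard_coeff p j n * x ^ n) N <= ((x ^ p + x ^ S p) / 2) ^ j.
Proof.
  intros Hx; rewrite <- (hadamard_coeff_sum_R p j (N + S p * j)) by lia.
  apply sum_n_mono; [|lia].
  intros n; apply Rmult_le_pos; [apply hadamard_coeff_nonneg|now apply pow_le].
Qed.

(** The blocks [p * j <= n <= S p * j] of distinct lacunary exponents are disjoint, so a
    coefficient [F n] of the composed series sees at most one lacunary term. *)
Lemma lacunary_sum_bound (b : nat -> C) (E : nat -> bool) (p : nat) (M q rho B : R) :
  (0 < p)%nat -> 0 <= rho -> rho < q -> 
  (forall i j, E i = true -> E j = true -> (i < j)%nat -> (S p * i < p * j)%nat) ->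
  (forall n, Cmod (sum_n (fun j => b j * hadamard_coeff p j n)%C n) <= M / q ^ n) ->
  (forall N, sum_n (fun j => if E j then 0 else Cmod (b j) * ((rho ^ p + rho ^ S p) / 2) ^ j) N <= B) ->
  forall N, sum_n (fun j => if E j then Cmod (b j) * ((rho ^ p + rho ^ S p) / 2) ^ j else 0) N
    <= M / (1 - rho / q) + B.
Proof.
  intros Hp Hrho Hq Hdisj HF HB J.
  set (sigma := (rho ^ p + rho ^ S p) / 2) in *.
  set (A := hadamard_coeff p) in *.
  (* The largest degree among the powers with [j <= J]: no lacunary polynomial is truncated at
     [N]. *)
  set (N := (S p * J)%nat).
  assert (A0 : forall j n, 0 <= A j n) by apply hadamard_coeff_nonneg.
  (* At order [n] at most one lacunary index [i] contributes. Its term is [F n] minus the gap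
     contributions, whose moduli are summed up to [N] so that the bound has the same range for every
     [n]. *)
  assert (Hcoef : forall n, (n <= N)%nat ->
    sum_n (fun j => if E j then Cmod (b j) * A j n else 0) J
    <= M / q ^ n + sum_n (fun j => if E j then 0 else Cmod (b j) * A j n) N).
  { intros n Hn.
    assert (Hrest : 0 <= sum_n (fun j => if E j then 0 else Cmod (b j) * A j n) N).
    { apply sum_n_nonneg; intros j; destruct (E j); [lra|].
      apply Rmult_le_pos; [apply Cmod_ge_0|apply A0]. }
    destruct (classic (exists i, E i = true /\ (i <= J)%nat /\ A i n <> 0)) as [(i & Ei & Hi & HA)|Hno].
    2: { rewrite sum_n_zero.
         - apply Rplus_le_le_0_compat; [|exact Hrest].
           eapply Rle_trans; [apply Cmod_ge_0|apply HF].
         - intros j Hj; destruct (E j) eqn:Ej; [|reflexivity].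
           destruct (Req_dec (A j n) 0) as [->|HA]; [ring|].
           exfalso; apply Hno; now exists j. }
    assert (Hin := hadamard_coeff_support p i n HA).
    assert (Hother : forall j, j <> i -> E j = true -> A j n = 0).
    { intros j Hj Ej; destruct (Req_dec (A j n) 0) as [|HA']; [assumption|exfalso].
      assert (Hjn := hadamard_coeff_support p j n HA').
      destruct (Nat.lt_total i j) as [H|[H|H]]; [|lia|].
      - assert (H' := Hdisj i j Ei Ej H); lia.
      - assert (H' := Hdisj j i Ej Ei H); lia. }
    rewrite (sum_n_single _ J i Hi).
    2: { intros j Hj; destruct (E j) eqn:Ej; [|reflexivity]. rewrite (Hother j) by assumption; ring. }
    rewrite Ei.
    assert (Hsplit : forall m, sum_n (fun j => b j * A j n)%C m =
      (sum_n (fun j => if E j then b j * A j n else RtoC 0)%C m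
       + sum_n (fun j => if E j then RtoC 0 else b j * A j n)%C m)%C).
    { intros m; symmetry.
      eapply eq_trans; [symmetry; apply (sum_n_plus (G := C_AbelianMonoid))|].
      apply sum_n_ext; intros j; destruct (E j); as_C; ring. }
    assert (Hsingle : forall m, (i <= m)%nat ->
      sum_n (fun j => if E j then b j * A j n else RtoC 0)%C m = (b i * A i n)%C).
    { assert (Hsm : forall m, sum_n (fun j => if E j then b j * A j n else RtoC 0)%C m
        = if Nat.leb i m then (b i * A i n)%C else RtoC 0).
      { assert (Ht : forall j, (if E j then b j * A j n else RtoC 0)%C
          = if Nat.eqb i j then (b i * A i n)%C else RtoC 0).
        { intros j; destruct (Nat.eqb_spec i j) as [<-|Hj]; [now rewrite Ei|].
          destruct (E j) eqn:Ej; [|reflexivity]. rewrite (Hother j) by auto; ring. }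
        intros m; induction m as [|m IH].
        - rewrite sum_O, Ht; destruct i; reflexivity.
        - rewrite sum_Sn, IH, Ht.
          destruct (Nat.leb_spec i m); destruct (Nat.eqb_spec i (S m));
            destruct (Nat.leb_spec i (S m)); try lia; as_C; ring. }
      intros m Hm; rewrite Hsm; apply Nat.leb_le in Hm; now rewrite Hm. }
    (* Here [i <= n] follows from [p * i <= n] and [0 < p], so the lacunary term does occur in the
       sum up to [n]. *)
    specialize (HF n); rewrite Hsplit, Hsingle in HF by nia.
    set (S0 := sum_n (fun j => if E j then RtoC 0 else b j * A j n)%C n) in *.
    assert (HS0 : Cmod S0 <= sum_n (fun j => if E j then 0 else Cmod (b j) * A j n) N).
    { apply Rle_trans with (sum_n (fun j => if E j then 0 else Cmod (b j) * A j n) n).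
      - eapply Rle_trans; [apply (norm_sum_n_m (V := C_NormedModule))|].
        apply sum_n_le_loc; intros j _; change (norm ?x) with (Cmod x); destruct (E j).
        + rewrite Cmod_0; lra.
        + rewrite Cmod_mult, Cmod_R, Rabs_pos_eq by apply A0; lra.
      - apply sum_n_mono; [|assumption].
        intros j; destruct (E j); [lra|]. apply Rmult_le_pos; [apply Cmod_ge_0|apply A0]. }
    replace (Cmod (b i) * A i n) with (Cmod (b i * A i n)).
    2: { rewrite Cmod_mult, Cmod_R, Rabs_pos_eq by apply A0; reflexivity. }
    replace (b i * A i n)%C with ((b i * A i n + S0) + - S0)%C by ring.
    eapply Rle_trans; [apply Cmod_triangle|]; rewrite Cmod_opp; lra. }
  assert (Hpos : forall n, 0 <= rho ^ n) by (intros n; now apply pow_le).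
  (* Interchange the finite sums: weighting order [n] by [rho ^ n] and summing over [n] rebuilds
     [sigma ^ j] exactly. *)
  assert (Hlhs : sum_n (fun j => if E j then Cmod (b j) * sigma ^ j else 0) J
    = sum_n (fun n => rho ^ n * sum_n (fun j => if E j then Cmod (b j) * A j n else 0) J) N).
  { symmetry; rewrite (sum_n_ext _ (fun n => sum_n (fun j => if E j then rho ^ n * (Cmod (b j) * A j n) else 0) J)).
    2: { intros n; rewrite <- sum_n_Rmult_l; apply sum_n_ext; intros j.
         destruct (E j); [reflexivity|apply Rmult_0_r]. }
    rewrite sum_n_switch; apply sum_n_ext_loc; intros j Hj; destruct (E j); [symmetry|now apply sum_n_zero].
    unfold sigma; rewrite <- (hadamard_coeff_sum_R p j N) by (unfold N; nia).
    rewrite <- sum_n_Rmult_l; apply sum_n_ext; intros n.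
    fold (A j n); as_R; ring. }
  rewrite Hlhs.
  apply Rle_trans with (sum_n (fun n => M * (rho / q) ^ n) N
    + sum_n (fun n => rho ^ n * sum_n (fun j => if E j then 0 else Cmod (b j) * A j n) N) N).
  { change (?x + ?y) with (plus x y); rewrite <- sum_n_plus.
    apply sum_n_le_loc; intros n Hn; change (plus ?x ?y) with (x + y).
    apply Rle_trans with (rho ^ n * (M / q ^ n + sum_n (fun j => if E j then 0 else Cmod (b j) * A j n) N)).
    - apply Rmult_le_compat_l; [apply Hpos|now apply Hcoef].
    - right; unfold Rdiv; rewrite Rpow_mult_distr, pow_inv; ring. }
  assert (HM : 0 <= M).
  { assert (X := Rle_trans _ _ _ (Cmod_ge_0 _) (HF 0%nat)); rewrite pow_O in X; lra. }
  apply Rplus_le_compat.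
  - assert (Hgeo : is_series (fun n => M * (rho / q) ^ n) (M / (1 - rho / q))).
    { apply (is_series_scal (V := R_NormedModule) M (fun n => (rho / q) ^ n)).
      apply is_series_geom; rewrite Rabs_pos_eq.
      - apply Rlt_div_l; lra.
      - apply Rdiv_le_0_compat; lra. }
    apply (is_lim_seq_le_loc (fun _ => sum_n (fun n => M * (rho / q) ^ n) N)
      (sum_n (fun n => M * (rho / q) ^ n)) (sum_n (fun n => M * (rho / q) ^ n) N) (M / (1 - rho / q))).
    + exists N; intros n Hn; apply sum_n_mono; [|assumption].
      intros j; apply Rmult_le_pos; [assumption|]. apply pow_le, Rdiv_le_0_compat; lra.
    + apply is_lim_seq_const.
    + exact Hgeo.
  (* The gap indices run up to [N], so their polynomials may be cut off at [N]; nonnegative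
     coefficients still give an upper bound by [sigma ^ j]. *)
  - eapply Rle_trans; [|apply (HB N)].
    rewrite (sum_n_ext _ (fun n => sum_n (fun j => if E j then 0 else rho ^ n * (Cmod (b j) * A j n)) N)).
    2: { intros n; rewrite <- sum_n_Rmult_l; apply sum_n_ext; intros j.
         destruct (E j); [apply Rmult_0_r|reflexivity]. }
    rewrite sum_n_switch; apply sum_n_le_loc; intros j Hj; destruct (E j).
    + right; now apply sum_n_zero.
    + apply Rle_trans with (Cmod (b j) * sum_n (fun n => A j n * rho ^ n) N).
      * right; rewrite <- sum_n_Rmult_l; apply sum_n_ext; intros n.
          as_R; ring.
      * apply Rmult_le_compat_l; [apply Cmod_ge_0|now apply hadamard_coeff_sum_le].
Qed.

(** * Hadamard's map slightly beyond the unit disc *)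

Lemma exists_above_one (q : R -> R) (B X : R) :
  ex_derive q 1 -> q 1 < B -> 1 < X -> exists x, 1 < x < X /\ q x < B.
Proof.
  intros Hq HB HX.
  apply ex_derive_continuous in Hq.
  destruct (Hq (fun y => y < B)) as [d Hd].
  { now apply open_lt. }
  exists (1 + Rmin d (X - 1) / 2).
  assert (M0 : 0 < Rmin d (X - 1)) by (apply Rmin_pos; [apply cond_pos|lra]).
  assert (M1 := Rmin_l d (X - 1)); assert (M2 := Rmin_r d (X - 1)).
  split; [lra|].
  apply Hd; change (Rabs (1 + Rmin d (X - 1) / 2 - 1) < d).
  rewrite Rabs_pos_eq; lra.
Qed.

Lemma C_differentiable_plus (f g : C -> C) (z : C) :
  C_differentiable f z -> C_differentiable g z -> C_differentiable (fun u => f u + g u)%C z.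
Proof. exact (ex_derive_plus (V := C_NormedModule) f g z). Qed.

(** Hadamard's substitution; it maps the closed unit disc into the disc of radius [Cmod w],
    reaching the boundary circle only at [w], for [x = 1]. *)
Definition hadamard_map (w : C) (p : nat) (x : C) : C := (w * ((x ^ p + x ^ S p) / 2))%C.

Lemma C_differentiable_hadamard_map (w : C) (p : nat) (x : C) :
  C_differentiable (hadamard_map w p) x.
Proof.
  unfold hadamard_map, Cdiv.
  apply (C_differentiable_mult (fun _ => w)); [apply C_differentiable_const|].
  apply (C_differentiable_mult (fun x => x ^ p + x ^ S p)%C (fun _ => (/ 2)%C));
    [|apply C_differentiable_const].
  apply (C_differentiable_plus (fun x => x ^ p)%C (fun x => x ^ S p)%C); apply C_differentiable_pow.
Qed.

(** Near [x = 1] continuity keeps the image within [eta] of [w]. Elsewhere [Cmod (1 + x)] stays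
    below 2 by a uniform margin, which leaves room for [Cmod x] to exceed 1 a little. *)
Lemma hadamard_map_near_boundary (w : C) (p : nat) (eta : R) :
  0 < Cmod w -> 0 < eta ->
  exists q, 1 < q /\ forall x, Cmod x <= q ->
    Cmod (hadamard_map w p x) < Cmod w \/ Cmod (hadamard_map w p x - w) < eta.
Proof.
  intros Hw Heta.
  assert (E1 : hadamard_map w p 1 = w).
  { unfold hadamard_map; rewrite !Cpow_1_l; field. }
  assert (Hc : exists d, 0 < d /\ forall x, Cmod (x - 1) < d -> Cmod (hadamard_map w p x - w) < eta).
  { destruct (C_differentiable_hadamard_map w p 1) as [l Hl].
    destruct (proj1 (C_derive_iff _ _ _) Hl (mkposreal 1 Rlt_0_1)) as [d Hd]; simpl in Hd.
    rewrite E1 in Hd.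
    assert (L0 := Cmod_ge_0 l).
    exists (Rmin d (eta / (1 + Cmod l))); split.
    { apply Rmin_pos; [apply cond_pos|apply Rdiv_lt_0_compat; lra]. }
    intros x Hx.
    assert (M1 := Rmin_l d (eta / (1 + Cmod l))); assert (M2 := Rmin_r d (eta / (1 + Cmod l))).
    specialize (Hd x ltac:(lra)).
    replace (hadamard_map w p x - w)%C with ((hadamard_map w p x - w - (x - 1) * l) + (x - 1) * l)%C by ring.
    eapply Rle_lt_trans; [apply Cmod_triangle|]; rewrite Cmod_mult.
    apply Rle_lt_trans with ((1 + Cmod l) * Cmod (x - 1)); [lra|].
    assert (Hx' : Cmod (x - 1) < eta / (1 + Cmod l)) by lra.
    apply Rmult_lt_compat_l with (r := 1 + Cmod l) in Hx'; [|lra].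
    replace ((1 + Cmod l) * (eta / (1 + Cmod l))) with eta in Hx' by (field; lra).
    exact Hx'. }
  destruct Hc as (d & Hd & Hnear).
  (* This function bounds the square of [Cmod x ^ p * Cmod (1 + x)] when [Cmod x <= q] and
     [d <= Cmod (x - 1)]. At [q = 1] it equals [4 - d ^ 2], so it remains below 4 for some
     [q > 1]. *)
  destruct (exists_above_one (fun q => q ^ (2 * p) * (2 + 2 * q ^ 2 - d ^ 2)) 4 2) as (q & Hq & Hlt).
  - auto_derive; exact I.
  - rewrite pow1; assert (0 < d ^ 2) by (apply pow_lt; assumption); lra.
  - lra.
  - exists q; split; [lra|]; intros x Hx.
    destruct (Rlt_le_dec (Cmod (x - 1)) d) as [Hxd|Hxd]; [right; now apply Hnear|left].
    (* Away from [1] the parallelogram law keeps [Cmod (1 + x)] below [2]. *)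
    assert (Hpar : Cmod (1 + x) ^ 2 + Cmod (x - 1) ^ 2 = 2 + 2 * Cmod x ^ 2).
    { rewrite !Cmod2_alt; destruct x as [u v]; unfold Re, Im; simpl; ring. }
    assert (Hd2 : d ^ 2 <= Cmod (x - 1) ^ 2) by (apply pow_incr; lra).
    assert (X0 := Cmod_ge_0 x).
    assert (Hx2 : Cmod x ^ 2 <= q ^ 2) by (apply pow_incr; lra).
    assert (Hxp : Cmod x ^ (2 * p) <= q ^ (2 * p)) by (apply pow_incr; lra).
    assert (Hm : Cmod (hadamard_map w p x) = Cmod w * (Cmod x ^ p * Cmod (1 + x) / 2)).
    { unfold hadamard_map.
      replace ((x ^ p + x ^ S p) / 2)%C with (x ^ p * (1 + x) * RtoC (/ 2))%C.
      - rewrite !Cmod_mult, Cmod_pow, Cmod_R, Rabs_pos_eq by lra; reflexivity.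
      - rewrite Cpow_S, RtoC_inv by lra; unfold Cdiv; ring. }
    rewrite Hm.
    rewrite <- (Rmult_1_r (Cmod w)) at 2; apply Rmult_lt_compat_l; [assumption|].
    assert (Hsq : (Cmod x ^ p * Cmod (1 + x)) ^ 2 < 2 ^ 2).
    { rewrite Rpow_mult_distr, <- pow_mult, Nat.mul_comm.
      apply Rle_lt_trans with (q ^ (2 * p) * (2 + 2 * q ^ 2 - d ^ 2)); [|lra].
      apply Rmult_le_compat; [now apply pow_le|apply pow2_ge_0|assumption|lra]. }
    apply Rnot_le_lt; intros Hge.
    assert (2 ^ 2 <= (Cmod x ^ p * Cmod (1 + x)) ^ 2) by (apply pow_incr; lra).
    lra.
Qed.

(** Near 0 the map satisfies [Cmod (hadamard_map w p x) <= Cmod w * Cmod x], so replacing [f] by its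
    partial sum of order [n] costs only a multiple of [Cmod x ^ S n]. Cauchy's estimate therefore
    applies to the coefficient of order [n] of the composed partial sum. *)
Lemma hadamard_coeff_decay (a : nat -> C) (f h : C -> C) (w : C) (p : nat) (q : R) :
  0 < Cmod w -> (0 < p)%nat -> 0 < q ->
  (forall z, Cmod z < Cmod w -> is_pseries (K := C_AbsRing) (V := C_NormedModule) a z (f z)) ->
  (forall z, Cmod z < Cmod w -> h z = f z) ->
  (forall x, Cmod x <= q -> C_differentiable h (hadamard_map w p x)) ->
  exists M, forall n,
    Cmod (sum_n (fun j => a j * w ^ j * hadamard_coeff p j n)%C n) <= M / q ^ n.
Proof.
  intros Hw Hp Hq Hf Hhf Hd.
  destruct (cauchy_estimate (fun x => h (hadamard_map w p x)) q Hq) as [M HM].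
  { intros x Hx; apply (C_differentiable_comp h (hadamard_map w p)); [now apply Hd|].
    apply C_differentiable_hadamard_map. }
  exists M; intros n.
  destruct (pseries_tail_bound a f (Cmod w) (Cmod w / 2) n Hf ltac:(lra)) as (K & HK0 & HK).
  (* [S p * n] is the degree of the composed partial sum; radius [1 / 2] keeps the image inside the
     disc of radius [Cmod w / 2], where the tail bound holds. *)
  apply (HM (fun k => sum_n (fun j => a j * w ^ j * hadamard_coeff p j k)%C n) n (S p * n)%nat
    (K * Cmod w ^ S n) (1 / 2)); [lra|lia|].
  intros x Hx.
  assert (X0 := Cmod_ge_0 x).
  assert (Hpow : Cmod x ^ p <= Cmod x).
  { destruct p as [|p']; [lia|]. simpl.
    assert (Cmod x ^ p' <= 1 ^ p') by (apply pow_incr; lra).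
    rewrite pow1 in H; nra. }
  assert (Hmap : Cmod (hadamard_map w p x) <= Cmod w * Cmod x).
  { unfold hadamard_map; rewrite Cmod_mult; apply Rmult_le_compat_l; [lra|].
    unfold Cdiv; rewrite Cmod_mult, <- RtoC_inv, Cmod_R, Rabs_pos_eq by lra.
    assert (T := Cmod_triangle (x ^ p) (x ^ S p)).
    rewrite !Cmod_pow in T; simpl in T.
    assert (0 <= Cmod x ^ p) by now apply pow_le.
    assert (Cmod x * Cmod x ^ p <= Cmod x) by nra.
    change (x * x ^ p)%C with (x ^ S p)%C in T; lra. }
  assert (Hhalf : Cmod w * Cmod x <= Cmod w * (1 / 2)) by (apply Rmult_le_compat_l; lra).
  rewrite Hhf by lra.
  assert (E : sum_n (fun k => sum_n (fun j => a j * w ^ j * hadamard_coeff p j k)%C n * x ^ k)%C (S p * n)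
    = sum_n (fun j => a j * hadamard_map w p x ^ j)%C n).
  { transitivity (sum_n (fun k => sum_n (fun j => a j * w ^ j * (hadamard_coeff p j k * x ^ k))%C n) (S p * n)).
    { apply sum_n_ext; intros k.
      eapply eq_trans; [symmetry; apply (sum_n_mult_r (K := C_Ring))|].
      apply sum_n_ext; intros j.
      match goal with |- mult ?s ?t = _ => change (mult s t) with (s * t)%C end; as_C; ring. }
    rewrite sum_n_switch; apply sum_n_ext_loc; intros j Hj.
    eapply eq_trans; [apply (sum_n_mult_l (K := C_Ring))|].
    rewrite hadamard_coeff_sum by nia.
    match goal with |- mult ?s ?t = _ => change (mult s t) with (s * t)%C end.
    unfold hadamard_map; rewrite (Cpow_mult_l w); as_C; ring. }
  rewrite E.
  eapply Rle_trans; [apply HK; lra|].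
  rewrite Rmult_assoc, <- Rpow_mult_distr; apply Rmult_le_compat_l; [assumption|].
  apply pow_incr; split; [apply Cmod_ge_0|assumption].
Qed.

(** * Quasi-Hadamard lacunary series *)

Section Lacunary.

Variables (a : nat -> C) (delta : R) (c : nat -> R) (m : nat -> nat).
Hypothesis c_pos : forall j, 0 < c j.
Hypothesis c_sum : ex_series c.
Hypothesis m_incr : forall v, (m v < m (S v))%nat.
Hypothesis a_gap : forall v j : nat, (m v < j < m (S v))%nat -> (0 < m v)%nat ->
  Cmod (a j) <= 1 / INR (m v) ^ 2 * c j.

Lemma m_mono (u v : nat) : (u < v)%nat -> (m u < m v)%nat.
Proof.
  intros H; induction H as [|v _ IH]; [apply m_incr|].
  specialize (m_incr v); lia.
Qed.

(** From [m 1] on, every gap follows some [m v >= 1], so its coefficients are at most [c j].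
    Starting at [m 1] avoids the possible value [m 0 = 0], and only finitely many terms are
    dropped. *)
Lemma gap_series_converges (E : nat -> bool) :
  (forall v, E (m v) = true) ->
  ex_series (fun j => if E j then 0 else Cmod (a j)).
Proof.
  intros HE.
  apply (ex_series_incr_n (V := R_NormedModule) _ (m 1)).
  apply (ex_series_le (V := R_CompleteNormedModule) _ (fun k => c (m 1 + k)%nat)).
  2: now apply (ex_series_incr_n (V := R_NormedModule)).
  intros k; set (j := (m 1 + k)%nat).
  change (Rabs (if E j then 0 else Cmod (a j)) <= c j).
  destruct (E j) eqn:Ej; [rewrite Rabs_R0; apply Rlt_le, c_pos|].
  rewrite Rabs_pos_eq by apply Cmod_ge_0.
  assert (Hv : exists v, (m v < j < m (S v))%nat /\ (0 < v)%nat).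
  { assert (Hex : forall n, (j < m (S n))%nat ->
      exists v, (m v < j < m (S v))%nat /\ (0 < v)%nat).
    { intros n; induction n as [|n IH]; intros Hn; [unfold j in Hn; lia|].
      destruct (Nat.lt_ge_cases j (m (S n))) as [H|H]; [now apply IH|].
      exists (S n); repeat split; try lia.
      assert (j <> m (S n)); [|lia]. intros Hj; rewrite Hj, HE in Ej; discriminate. }
    apply (Hex j).
    assert (Hge : forall n, (n <= m n)%nat).
    { intros n; induction n as [|n IH]; [lia|]. specialize (m_incr n); lia. }
    specialize (Hge (S j)); lia. }
  destruct Hv as (v & Hj & Hv).
  assert (Hmv : (1 <= m v)%nat) by (assert (X := m_mono 0 v Hv); lia).
  eapply Rle_trans; [apply (a_gap v j Hj); lia|].
  rewrite <- (Rmult_1_l (c j)) at 2; apply Rmult_le_compat_r; [apply Rlt_le, c_pos|].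
  assert (H1 : 1 <= INR (m v)) by (apply (le_INR 1); assumption).
  assert (1 <= INR (m v) ^ 2) by nra.
  apply Rle_div_l; lra.
Qed.

Lemma subsequence_series_converges :
  ex_series (fun j => Cmod (a j)) -> ex_series (fun v => Cmod (a (m v))).
Proof.
  intros Ha.
  destruct (sum_n_le_series _ (fun j => Cmod_ge_0 (a j)) Ha) as [B HB].
  apply ex_series_of_bounded with B; [intros; apply Cmod_ge_0|].
  intros V; eapply Rle_trans; [|apply (HB (m V))].
  induction V as [|V IH].
  - rewrite sum_O.
    destruct (m 0) as [|k]; [rewrite sum_O; lra|rewrite sum_Sn].
    change (plus ?x ?y) with (x + y).
    assert (X := sum_n_nonneg (fun j => Cmod (a j)) k (fun j => Cmod_ge_0 _)); lra.
  - rewrite sum_Sn; change (plus ?x ?y) with (x + y).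
    destruct (m (S V)) as [|k] eqn:Ek; [specialize (m_incr V); lia|].
    rewrite sum_Sn; change (plus ?x ?y) with (x + y).
    apply Rplus_le_compat_r; eapply Rle_trans; [exact IH|].
    apply sum_n_mono; [intros; apply Cmod_ge_0|]. specialize (m_incr V); lia.
Qed.

Hypothesis m_gap : forall v : nat, INR (m (S v)) - INR (m v) > delta * INR (m v).

(** Multiplying the gap condition by [p] gives [p * m (S u) > p * m u + p * delta * m u], and the
    last term is at least [m u]. *)
Lemma lacunary_blocks_disjoint (p u v : nat) :
  1 <= INR p * delta -> (u < v)%nat -> (S p * m u < p * m v)%nat.
Proof.
  intros Hp Huv.
  apply Nat.lt_le_trans with (p * m (S u))%nat.
  - apply INR_lt; rewrite !mult_INR, S_INR.
    assert (H := m_gap u); assert (M0 := pos_INR (m u)); assert (P0 := pos_INR p).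
    assert (Hp0 : 0 < INR p) by (destruct P0 as [|P0]; [assumption|rewrite <- P0 in Hp; lra]).
    apply Rmult_lt_compat_l with (r := INR p) in H; [|assumption]. nra.
  - apply Nat.mul_le_mono_l.
    destruct (Nat.eq_dec (S u) v) as [->|Hne]; [lia|].
    apply Nat.lt_le_incl, m_mono; lia.
Qed.

End Lacunary.

(** * The circle of convergence as natural boundary *)

Theorem theorem4p4 (a : nat -> C) (r : R) (f : C -> C)
  (ha : quasi_Hadamard_lacunary a)
  (hr : 0 < r)
  (hrad : C_CV_radius a = Finite r)
  (hf : forall z : C, Cmod z < r -> is_pseries (K := C_AbsRing) (V := C_NormedModule) a z (f z)) :
  disc_is_domain_of_holomorphy r f.
Proof.
  destruct ha as (delta & c & m & Hdelta & c_pos & _ & _ & c_sum & m_incr & m_gap & a_gap & Hdiv).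
  intros w Hw (U & g & HU & HUw & Hg & Hgf).
  (* If [r > 1], the series converges absolutely at 1, against the divergence of the lacunary
     moduli. *)
  assert (Hr1 : r <= 1).
  { apply Rnot_lt_le; intros Hr; apply Hdiv, (subsequence_series_converges a m m_incr).
    assert (H := ex_series_Cmod_of_lt a f r 1 hf ltac:(lra)).
    revert H; apply ex_series_ext; intros j; rewrite pow1; apply Rmult_1_r. }
  assert (Hp : exists p, (0 < p)%nat /\ 1 <= INR p * delta).
  { destruct (INR_unbounded (/ delta)) as [p Hp].
    assert (0 < / delta) by now apply Rinv_0_lt_compat.
    exists p; split; [apply INR_lt; simpl; lra|].
    apply Rmult_lt_compat_r with (r := delta) in Hp; [|assumption].
    rewrite Rinv_l in Hp; lra. }
  destruct Hp as (p & Hp0 & Hp).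
  set (E := fun j => if excluded_middle_informative (exists v, m v = j) then true else false).
  assert (HE : forall v, E (m v) = true).
  { intros v; unfold E; destruct excluded_middle_informative as [|Hn]; [reflexivity|].
    exfalso; apply Hn; now exists v. }
  assert (HE' : forall j, E j = true -> exists v, m v = j).
  { intros j; unfold E; destruct excluded_middle_informative; [trivial|discriminate]. }
  assert (Hdisj : forall i j, E i = true -> E j = true -> (i < j)%nat -> (S p * i < p * j)%nat).
  { intros i j [u <-]%HE' [v <-]%HE' Hij.
    apply (lacunary_blocks_disjoint delta m m_incr m_gap); [assumption|].
    apply Nat.nle_gt; intros Hvu.
    destruct (Nat.eq_dec v u) as [->|Hne]; [lia|].
    assert (X := m_mono m m_incr v u ltac:(lia)); lia. }
  destruct (sum_n_le_series (fun j => if E j then 0 else Cmod (a j))) as [B HB].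
  { intros j; destruct (E j); [lra|apply Cmod_ge_0]. }
  { now apply gap_series_converges with c m. }
  set (h := fun z => if Rlt_dec (Cmod z) r then f z else g z).
  assert (Hhf : forall z, Cmod z < r -> h z = f z).
  { intros z Hz; unfold h; destruct Rlt_dec; [reflexivity|contradiction]. }
  assert (Hhg : forall z, U z -> h z = g z).
  { intros z Hz; unfold h; destruct Rlt_dec; [symmetry; now apply Hgf|reflexivity]. }
  assert (Hdf : forall z, Cmod z < r -> C_differentiable h z).
  { intros z Hz; destruct (C_differentiable_pseries a f r hf z Hz) as [l Hl].
    exists l; revert Hl; apply is_derive_ext_loc.
    assert (Hd : 0 < r - Cmod z) by lra.
    exists (mkposreal _ Hd); intros u Hu; symmetry; apply Hhf.
    change (Cmod (u - z) < r - Cmod z) in Hu.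
    replace u with ((u - z) + z)%C by ring.
    eapply Rle_lt_trans; [apply Cmod_triangle|lra]. }
  assert (Hdg : forall z, U z -> C_differentiable h z).
  { intros z Hz; destruct (Hg z Hz) as [l Hl].
    exists l; revert Hl; apply is_derive_ext_loc.
    apply locally_C; generalize (HU z Hz); apply filter_imp.
    intros u Hu; symmetry; now apply Hhg. }
  (* A ball of radius [eta] about [w] lies in [U], so Hadamard's map sends the disc of radius [q]
     into the union of [B(r,0)] and [U], where [h] is holomorphic. *)
  destruct (HU w HUw) as [eta Heta].
  destruct (hadamard_map_near_boundary w p eta) as (q & Hq & Hmap); [lra|apply cond_pos|].
  destruct (hadamard_coeff_decay a f h w p q) as [M HM]; try lra; try lia.
  { intros z Hz; apply hf; lra. }
  { intros z Hz; apply Hhf; lra. }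
  { intros x Hx; destruct (Hmap x Hx) as [H|H]; [apply Hdf; lra|apply Hdg].
    apply Heta, C_NormedModule_mixin_compat1, H. }
  assert (Hkey : forall rho, 1 <= rho < q -> r * ((rho ^ p + rho ^ S p) / 2) <= 1 ->
    ex_series (fun j => Cmod (a j) * (r * ((rho ^ p + rho ^ S p) / 2)) ^ j)).
  { intros rho Hrho Hle; set (sigma := (rho ^ p + rho ^ S p) / 2) in *.
    assert (Hs0 : 0 <= sigma).
    { assert (0 <= rho ^ p) by (apply pow_le; lra).
      assert (0 <= rho ^ S p) by (apply pow_le; lra). unfold sigma; lra. }
    assert (Hrs : 0 <= r * sigma) by (apply Rmult_le_pos; lra).
    assert (Hterm : forall j, Cmod (a j * w ^ j) * sigma ^ j = Cmod (a j) * (r * sigma) ^ j).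
    { intros j; rewrite Cmod_mult, Cmod_pow, Hw, Rpow_mult_distr; ring. }
    (* Since [r * sigma <= 1], the gap terms are at most [Cmod (a j)], whose gap sums are bounded by
       [B]. *)
    assert (HG : forall N, sum_n (fun j => if E j then 0 else Cmod (a j * w ^ j) * sigma ^ j) N <= B).
    { intros N; eapply Rle_trans; [|apply (HB N)].
      apply sum_n_le_loc; intros j _; destruct (E j); [lra|].
      rewrite Hterm; rewrite <- (Rmult_1_r (Cmod (a j))) at 2.
      apply Rmult_le_compat_l; [apply Cmod_ge_0|].
      rewrite <- (pow1 j); apply pow_incr; lra. }
    assert (HL := lacunary_sum_bound (fun j => a j * w ^ j)%C E p M q rho B Hp0 ltac:(lra) ltac:(lra)
      Hdisj HM HG).
    apply ex_series_of_bounded with (M / (1 - rho / q) + B + B).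
    { intros j; apply Rmult_le_pos; [apply Cmod_ge_0|now apply pow_le]. }
    intros N.
    eapply Rle_trans; [|exact (Rplus_le_compat _ _ _ _ (HL N) (HG N))].
    right; symmetry; eapply eq_trans; [symmetry; apply (sum_n_plus (G := R_AbelianMonoid))|].
    apply sum_n_ext; intros j; rewrite <- Hterm; fold sigma.
    change (plus ?x ?y) with (x + y); destruct (E j); as_R; ring. }
  destruct Hr1 as [Hr1|Hr1].
  (* Case [r < 1]: some [rho > 1] still has [r * sigma < 1]. Then [sigma > 1], and [Hkey] gives
     absolute convergence at [s = r * sigma > r]. *)
  - destruct (exists_above_one (fun rho => r * ((rho ^ p + rho ^ S p) / 2)) 1 q) as (rho & Hrho & Hle).
    + auto_derive; exact I.
    + rewrite !pow1; lra.
    + lra.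
    + specialize (Hkey rho ltac:(lra) ltac:(lra)).
      set (s := r * ((rho ^ p + rho ^ S p) / 2)) in *.
      assert (Hs : r < s).
      { assert (P1 : 1 < rho ^ p) by (apply Rlt_pow_R1; [lra|assumption]).
        assert (P2 : 1 < rho ^ S p) by (apply Rlt_pow_R1; [lra|lia]).
        unfold s; nra. }
      assert (Hub : Rbar_le s (C_CV_radius a)).
      { apply (Lub_Rbar_correct (fun x => exists z : C, Cmod z = x /\
          ex_pseries (K := C_AbsRing) (V := C_NormedModule) a z)).
        exists (RtoC s); split; [rewrite Cmod_R; apply Rabs_pos_eq; lra|].
        destruct (ex_C_series_le (fun j => a j * RtoC s ^ j)%C (fun j => Cmod (a j) * s ^ j)) as [l Hl].
        - intros j; right; rewrite Cmod_mult, Cmod_pow, Cmod_R, Rabs_pos_eq by lra; reflexivity.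
        - exact Hkey.
        - exists l; now apply is_C_pseries. }
      rewrite hrad in Hub; simpl in Hub; lra.
  (* Case [r = 1]: with [rho = 1] the base [r * sigma] is exactly 1, so [Hkey] makes the sum of all
     [Cmod (a j)] finite. *)
  - apply Hdiv, (subsequence_series_converges a m m_incr).
    specialize (Hkey 1 ltac:(lra)); rewrite !pow1 in Hkey.
    specialize (Hkey ltac:(lra)); revert Hkey; apply ex_series_ext; intros j.
    replace (r * ((1 + 1) / 2)) with 1 by lra; rewrite pow1; apply Rmult_1_r.
Qed.
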